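(* Let $\lambda=e^{2\pi i\omega}$ with $\omega\in\mathbb R\setminus\mathbb Q$, and let $\mathcal F$ be one of the following three families of local real analytic diffeomorphisms $F(z)=\lambda z\bigl(1+f(|z|^2)\bigr)e^{2\pi i g(z)}$ of $(\mathbb R^2,0)$: the family $\mathcal F_\lambda$ in which $f$ and $g$ are both arbitrary; the family $\mathcal F_{\lambda,\bullet,g}$ in which $g$ is fixed and $f$ is arbitrary; the family $\mathcal F_{\lambda,f,\bullet}$ in which $f$ is fixed and $g$ is arbitrary. Then: (a) either the basic normalization of every $F\in\mathcal F$ is convergent, or all the normalizations of a generic $F\in\mathcal F$ are divergent; (b) either the basic normal form of every $F\in\mathcal F$ is convergent, or the basic normal form of a generic $F\in\mathcal F$ is divergent.
   Context: $\mathbb R^2$ is identified with $\mathbb C$. Here $f(u)=\sum_{j\ge1}f_ju^j$ ($f_j\in\mathbb R$) and $g(z)=\sum_{j+k\ge1}g_{jk}z^j\bar z^k$ ($g_{jk}=\overline{g_{kj}}$) are real analytic germs. A normal form is a formal map $N(z)=\lambda z\bigl(1+\sum_{k\ge1}\alpha_k|z|^{2k}\bigr)$, $\alpha_k\in\mathbb C$; a normalization of $F$ is a formal diffeomorphism $\Psi(z)=z+\sum_{p+q\ge2}\psi_{pq}z^p\bar z^q$ such that $\Psi\circ F\circ\Psi^{-1}$ is a normal form. The basic normalization of $F$ is the unique normalization of the form $\Phi^*(z)=ze^{2\pi i\varphi^*(z)}$ with $\varphi^*(z)=\sum_{p+q\ge1,\,p\ne q}\varphi^*_{pq}z^p\bar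 z^q$, $\varphi^*_{qp}=\overline{\varphi^*_{pq}}$ (no terms with $p=q$). The basic normal form is $N^*=\Phi^*\circ F\circ(\Phi^* )^{-1}$, which has the form $N^*(z)=\lambda z\bigl(1+f(|z|^2)\bigr)e^{2\pi i n^*(|z|^2)}$ with $n^*(u)=\sum_{s\ge1}n^*_su^s$, $n_s^*\in\mathbb R$. A series is convergent if it converges in some neighborhood of $0$, and divergent otherwise. The family $\mathcal F$ is identified with the real vector space of the free data ($(f,g)$, $f$, or $g$ respectively), endowed with a vector space topology for which each coefficient $f_j$, $g_{jk}$ is a continuous function. A property holds for a generic $F\in\mathcal F$ if the set of $F$ having it contains a countable intersection of open dense subsets of $\mathcal F$. *)

(* Defs.v *)
From HB Require Import structures.
From mathcomp Require Import all_boot all_order all_algebra.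
From mathcomp Require Import all_classical all_reals all_analysis.
From mathcomp Require Export complex.

Set Implicit Arguments.
Unset Strict Implicit.
Unset Printing Implicit Defensive.

Import Order.TTheory GRing.Theory Num.Theory.
Import numFieldNormedType.Exports.

Local Open Scope classical_set_scope.
Local Open Scope ring_scope.
Local Open Scope complex_scope.

Section FormalSeries.
Variable R : realType.

(** [a : series2] stands for the formal series
    \sum_(j, k) a_jk z^j zbar^k.  A formal self-map of (R^2, 0) = (C, 0) is
    such a series with [a 0 0 = 0]; analytic germs are identified with their
    convergent Taylor series in z and zbar. *)
Definition series2 := nat -> nat -> R[i].

Definition one2 : series2 := fun j k => ((j == 0%N) && (k == 0%N))%:R.

Definition z2 : series2 := fun j k => ((j == 1%N) && (k == 0%N))%:R.

Definition add2 (a b : series2) : series2 := fun j k => a j k + b j k.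

Definition scale2 (c : R[i]) (a : series2) : series2 := fun j k => c * a j k.

Definition mul2 (a b : series2) : series2 := fun j k =>
  \sum_(p < j.+1) \sum_(q < k.+1) a p q * b (j - p)%N (k - q)%N.

Definition pow2 (a : series2) (n : nat) : series2 := iter n (mul2 a) one2.

(** The series of the complex conjugate of the map [a]. *)
Definition conj2 (a : series2) : series2 := fun j k => (a k j)^*.

(** The exponential of [a], meant for [a 0 0 = 0]: then [a]^n has order at
    least n, so that the omitted terms n > j + k do not contribute. *)
Definition exp2 (a : series2) : series2 := fun j k =>
  \sum_(n < (j + k).+1) (n`!%:R)^-1 * pow2 a n j k.

(** The composition (a o b)(z) = \sum_(p, q) a_pq b(z)^p (conj b(z))^q, meant
    for [b 0 0 = 0]: the terms with p + q > j + k do not contribute. *)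
Definition comp2 (a b : series2) : series2 := fun j k =>
  \sum_(p < (j + k).+1) \sum_(q < (j + k).+1)
    a p q * mul2 (pow2 b p) (pow2 (conj2 b) q) j k.

(** The series a(|z|^2) of a one-variable series a(u). *)
Definition radial (a : nat -> R[i]) : series2 := fun j k =>
  if j == k then a j else 0.

(** The series e^(2 pi i h(z)). *)
Definition expi2 (h : series2) : series2 :=
  exp2 (scale2 (0 +i* (2 * pi)) h).

(** Convergence near 0 of a multiple power series is absolute convergence. *)
Definition convergent2 (a : series2) : Prop :=
  exists2 r : R, 0 < r & forall z : R[i], Normc.normc z < r ->
    summable [set: nat * nat]
      (fun p => (Normc.normc (a p.1 p.2 * z ^+ p.1 * (z^*) ^+ p.2))%:E).

Definition convergent1 (f : nat -> R) : Prop :=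
  exists2 r : R, 0 < r & forall u : R, `|u| < r ->
    cvg (pseries f u @ \oo).

(** [Rcomplex R] is [R[i]] as a vector space over [R]. *)
Definition fcoef : lmodType R := (nat -> R^o).
Definition gcoef : lmodType R := (nat -> nat -> Rcomplex R).

Definition fgerm : set fcoef := [set f | f 0%N = 0 /\ convergent1 f].

Definition hermitian2 (g : series2) : Prop := forall j k, g j k = (g k j)^*.

Definition ggerm : set gcoef :=
  [set g | [/\ g 0%N 0%N = 0, hermitian2 g & convergent2 g]].

(** F(z) = lambda z (1 + f(|z|^2)) e^(2 pi i g(z)) *)
Definition diffeo (lambda : R[i]) (f : fcoef) (g : gcoef) : series2 :=
  scale2 lambda (mul2 z2
    (mul2 (add2 one2 (radial (fun j => (f j)%:C))) (expi2 g))).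

Definition normal_form (lambda : R[i]) (N : series2) : Prop :=
  exists2 alpha : nat -> R[i], alpha 0%N = 0 &
    N = scale2 lambda (mul2 z2 (add2 one2 (radial alpha))).

Definition tangent_id (Psi : series2) : Prop :=
  [/\ Psi 0%N 0%N = 0, Psi 1%N 0%N = 1 & Psi 0%N 1%N = 0].

Definition inverse2 (Psi Psi' : series2) : Prop :=
  [/\ Psi' 0%N 0%N = 0, comp2 Psi Psi' = z2 & comp2 Psi' Psi = z2].

(** [N] is the conjugate Psi o F o Psi^-1. *)
Definition conjugate_by (Psi F N : series2) : Prop :=
  exists2 Psi', inverse2 Psi Psi' & N = comp2 Psi (comp2 F Psi').

Definition normalization (lambda : R[i]) (F Psi : series2) : Prop :=
  tangent_id Psi /\
  exists2 N, conjugate_by Psi F N & normal_form lambda N.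

Definition basic_normalization (lambda : R[i]) (F Phi : series2) : Prop :=
  normalization lambda F Phi /\
  exists phi : series2, [/\ forall p, phi p p = 0, hermitian2 phi &
    Phi = mul2 z2 (expi2 phi)].

Definition basic_normal_form (lambda : R[i]) (F N : series2) : Prop :=
  exists2 Phi, basic_normalization lambda F Phi & conjugate_by Phi F N.

(** e^(2 pi i omega) *)
Definition multiplier (omega : R) : R[i] :=
  cos (2 * pi * omega) +i* sin (2 * pi * omega).

Definition generic (E : topologicalType) (P : set E) : Prop :=
  exists2 U : nat -> set E, (forall n, open (U n) /\ dense (U n)) &
    \bigcap_n U n `<=` P.

Definition fcoef_continuous (E : topologicalType) (f : E -> fcoef) : Prop :=
  forall j, continuous (fun v => f v j : R).

Definition gcoef_continuous (E : topologicalType) (g : E -> gcoef) : Prop :=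
  forall j k, continuous (fun v => complex.Re (g v j k) : R) /\
              continuous (fun v => complex.Im (g v j k) : R).

(** [diffeo_family lambda F]: the map [F] is one of the three families, indexed
    by a topological vector space [E] that is identified, through a linear
    bijection with continuous coefficients, with the space of free data.  In
    the last two cases the datum which is not free is fixed. *)
Variant diffeo_family (lambda : R[i]) (E : topologicalLmodType R) :
    (E -> series2) -> Prop :=
| family_fg (d : {linear E -> (fcoef * gcoef)%type}) of
    set_bij [set: E] (fgerm `*` ggerm) d &
    fcoef_continuous (fun v => (d v).1) &
    gcoef_continuous (fun v => (d v).2) :
    diffeo_family lambda (fun v => diffeo lambda (d v).1 (d v).2)
| family_f (g : gcoef) (d : {linear E -> fcoef}) of
    ggerm g &
    set_bij [set: E] fgerm d &
    fcoef_continuous d :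
    diffeo_family lambda (fun v => diffeo lambda (d v) g)
| family_g (f : fcoef) (d : {linear E -> gcoef}) of
    fgerm f &
    set_bij [set: E] ggerm d &
    gcoef_continuous d :
    diffeo_family lambda (fun v => diffeo lambda f (d v)).

End FormalSeries.

(* Main.v *)
(** Since Phi(z) = z e^(2 pi i phi(z)) preserves |z| and |F(z)| depends only on
    |z|, the conjugacy equation is linear in phi: it reads
    phi o F - phi + g = n(|z|^2), and is solved degree by degree because
    lambda^(p-q) <> 1 for p <> q.  Giving f_j weight 2j and g_jk weight j + k,
    the coefficient of z^j zbar^k in Phi (and in the normal form N) is a
    polynomial of degree at most j + k in the coefficients of f and g.

    Hence for fixed M the data with |Phi_jk| <= M^(j+k+1) for all j, k form a
    closed set.  If one of these sets has an interior point v0, then on every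
    line through v0 the coefficients are polynomials of degree at most j + k,
    bounded by M^(j+k+1) on a segment; extrapolating along the line gives
    geometric bounds at all data, so everything converges.  Otherwise the
    complements are open and dense, and divergence is generic.

    Finally, a normalization Psi factors as Psi = Phi h(|z|^2), so that
    log (Psi / z) = 2 pi i phi + log h(|z|^2) has phi as its off-diagonal part,
    and convergence of Psi forces convergence of Phi. *)

Require Import Defs.
From HB Require Import structures.
From mathcomp Require Import all_boot all_order all_algebra.
From mathcomp Require Import all_classical all_reals all_analysis.
From mathcomp Require Import zify ring lra.

Set Implicit Arguments.
Unset Strict Implicit.
Unset Printing Implicit Defensive.

Import Order.TTheory GRing.Theory Num.Theory.
Import numFieldNormedType.Exports.

Local Open Scope classical_set_scope.
Local Open Scope ring_scope.
Local Open Scope complex_scope.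

(** * The ring of formal series *)

Section SeriesRing.
Variable R : realType.
Local Notation C := R[i].
Local Notation S := (series2 R).

HB.instance Definition _ := GRing.Zmodule.copy S (nat -> nat -> C).

Lemma coefD (a b : S) j k : (a + b) j k = a j k + b j k. Proof. by []. Qed.

Lemma seriesP (a b : S) : (forall j k, a j k = b j k) -> a = b.
Proof. by move=> ab; apply/funext => j; apply/funext => k. Qed.

Lemma scale2A c d (a : S) : scale2 c (scale2 d a) = scale2 (c * d) a.
Proof. by apply: seriesP => j k; rewrite /scale2 mulrA. Qed.

Lemma scale2_1 : left_id 1 (@scale2 R).
Proof. by move=> a; apply: seriesP => j k; rewrite /scale2 mul1r. Qed.

Lemma scale2Dr : right_distributive (@scale2 R) (+%R : S -> S -> S).
Proof. by move=> c a b; apply: seriesP => j k; rewrite /scale2 !coefD mulrDr. Qed.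

Lemma scale2Dl (a : S) : {morph (@scale2 R)^~ a : c d / c + d >-> (c + d : S)}.
Proof. by move=> c d; apply: seriesP => j k; rewrite /scale2 coefD mulrDl. Qed.

HB.instance Definition _ := GRing.Zmodule_isLmodule.Build C S
  scale2A scale2_1 scale2Dr scale2Dl.

Lemma add2E (a b : S) : add2 a b = a + b. Proof. by []. Qed.
Lemma scale2E c (a : S) : scale2 c a = c *: a. Proof. by []. Qed.
Lemma coefN (a : S) j k : (- a) j k = - a j k. Proof. by []. Qed.
Lemma coefB (a b : S) j k : (a - b) j k = a j k - b j k. Proof. by []. Qed.
Lemma coefZ c (a : S) j k : (c *: a) j k = c * a j k. Proof. by []. Qed.
Lemma coef0 j k : (0 : S) j k = 0. Proof. by []. Qed.

Lemma coef_sum I (r : seq I) P (f : I -> S) j k :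
  (\sum_(i <- r | P i) f i) j k = \sum_(i <- r | P i) f i j k.
Proof.
by elim/big_rec2: _ => // i x y _ <-.
Qed.

Definition series_linear (L : S -> S) := forall c x y, L (c *: x + y) = c *: L x + L y.

Definition mono (p q : nat) : S := fun j k => ((j == p) && (k == q))%:R.

(** [ord n a] puts [a] in the n-th power of the maximal ideal generated by z and zbar, the
    filtration of the adic topology in which all continuity arguments take place. *)
Definition ord (n : nat) (a : S) := forall j k, (j + k < n)%N -> a j k = 0.

Lemma ord_le m n a : (m <= n)%N -> ord n a -> ord m a.
Proof. by move=> mn a0 j k jk; apply: a0; apply: leq_trans mn. Qed.

Lemma ordD n a b : ord n a -> ord n b -> ord n (a + b).
Proof. by move=> a0 b0 j k jk; rewrite coefD a0 // b0 // addr0. Qed.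

Lemma ordN n a : ord n a -> ord n (- a).
Proof. by move=> a0 j k jk; rewrite coefN a0 // oppr0. Qed.

Lemma ordB n a b : ord n a -> ord n b -> ord n (a - b).
Proof. by move=> a0 b0; apply: ordD => //; apply: ordN. Qed.

Lemma ordZ n c a : ord n a -> ord n (c *: a).
Proof. by move=> a0 j k jk; rewrite coefZ a0 // mulr0. Qed.

(* [ord n] is a neighborhood basis of 0: a continuous linear map is
   determined by its values on monomials. *)
Lemma lin_ext (L1 L2 : S -> S) : series_linear L1 -> series_linear L2 ->
  (forall n a, ord n a -> ord n (L1 a)) ->
  (forall n a, ord n a -> ord n (L2 a)) ->
  (forall p q, L1 (mono p q) = L2 (mono p q)) -> L1 =1 L2.
Proof.
move=> lin1 lin2 c1 c2 eqm a.
have sub (L : S -> S) x y : series_linear L -> L (x - y) = L x - L y.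
  move=> linL; have -> : x - y = (-1) *: y + x by rewrite scaleN1r addrC.
  by rewrite linL scaleN1r addrC.
(* The polynomial truncation of [a] to indices below [n]. It contains every monomial of total degree
   below [n], so the remainder has order at least [n]. *)
pose t n : S := \sum_(p < n) \sum_(q < n) a p q *: mono p q.
have tE n : ord n (a - t n).
  move=> j k jk; rewrite coefB /t coef_sum.
  under eq_bigr do rewrite coef_sum.
  have jn : (j < n)%N by lia.
  have kn : (k < n)%N by lia.
  rewrite (bigD1 (Ordinal jn)) //= (bigD1 (Ordinal kn)) //=.
  rewrite coefZ /mono !eqxx /= mulr1 !big1 ?addr0 ?addr0 ?subrr // => i ne.
  - rewrite big1 // => i' _; rewrite coefZ; case: eqP => [ji|_]; rewrite ?mulr0 //.
    by move: ne; rewrite -val_eqE /= ji eqxx.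
  - rewrite coefZ; case: (k =P i) => [ki|_]; last by rewrite andbF mulr0.
    by move: ne; rewrite -val_eqE /= ki eqxx.
have eqt n : L1 (t n) = L2 (t n).
  have sumL (L : S -> S) (linL : series_linear L) : L (t n) =
      \sum_(p < n) \sum_(q < n) a p q *: L (mono p q).
    have L0 : L 0 = 0 by have := sub L 0 0 linL; rewrite !subrr.
    have LD x y : L (x + y) = L x + L y.
      by rewrite -[x]scale1r linL !scale1r.
    rewrite /t (big_morph L LD L0); apply: eq_bigr => p _.
    rewrite (big_morph L LD L0); apply: eq_bigr => q _.
    by rewrite -[_ *: mono _ _]addr0 linL L0 addr0.
  rewrite !sumL //; apply: eq_bigr => p _; apply: eq_bigr => q _.
  by rewrite eqm.
apply: seriesP => j k.
have e1 := c1 _ _ (tE (j + k).+1) _ _ (leqnn _).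
have e2 := c2 _ _ (tE (j + k).+1) _ _ (leqnn _).
move: e1 e2; rewrite !sub // !coefB eqt => /eqP + /eqP.
by rewrite !subr_eq0 => /eqP -> /eqP ->.
Qed.

Lemma mul2_linl b : series_linear (fun a : S => mul2 a b : S).
Proof.
move=> c x y; apply: seriesP => j k; rewrite coefD coefZ /mul2.
rewrite mulr_sumr -big_split /=; apply: eq_bigr => p _.
rewrite mulr_sumr -big_split /=; apply: eq_bigr => q _.
by rewrite coefD coefZ mulrDl mulrA.
Qed.

Lemma mul2_linr a : series_linear (fun b : S => mul2 a b : S).
Proof.
move=> c x y; apply: seriesP => j k; rewrite coefD coefZ /mul2.
rewrite mulr_sumr -big_split /=; apply: eq_bigr => p _.
rewrite mulr_sumr -big_split /=; apply: eq_bigr => q _.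
by rewrite coefD coefZ mulrDr mulrCA.
Qed.

Lemma ord_mul2 m n a b : ord m a -> ord n b -> ord (m + n) (mul2 a b).
Proof.
move=> a0 b0 j k jk; rewrite /mul2 big1 // => p _; rewrite big1 // => q _.
have [pq|pq] := ltnP (p + q) m; first by rewrite a0 // mul0r.
by rewrite b0 ?mulr0 //; have := ltn_ord p; have := ltn_ord q; lia.
Qed.

Lemma mul2_mono p q a j k : mul2 (mono p q) a j k =
  if (p <= j)%N && (q <= k)%N then a (j - p)%N (k - q)%N else 0.
Proof.
rewrite /mul2; case: ifPn => [/andP[pj qk]|npq].
  rewrite (bigD1 (Ordinal (pj : (p < j.+1)%N))) //=.
  rewrite (bigD1 (Ordinal (qk : (q < k.+1)%N))) //=.
  rewrite /mono !eqxx mul1r !big1 ?addr0 ?addr0 // => i ne.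
  - rewrite big1 // => i' _; case: eqP => [ji|_]; rewrite ?mul0r //.
    by move: ne; rewrite -val_eqE /= ji eqxx.
  - case: (_ =P q) => [ki|_]; last by rewrite andbF mul0r.
    by move: ne; rewrite -val_eqE /= ki eqxx.
rewrite big1 // => i _; rewrite big1 // => i' _; rewrite /mono.
case: eqP => ip; last by rewrite mul0r.
case: eqP => iq; last by rewrite mul0r.
by move: npq; rewrite -ip -iq -ltnS ltn_ord -ltnS ltn_ord.
Qed.

Lemma mul2_mono2 p q r s : mul2 (mono p q) (mono r s) = mono (p + r) (q + s).
Proof.
apply: seriesP => j k; rewrite mul2_mono /mono.
case: ifPn => h.
  by congr ((_ : bool)%:R); apply/idP/idP => /andP[/eqP ? /eqP ?]; apply/andP; split; apply/eqP; lia.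
case: (j =P _) => [?|//]; case: (k =P _) => [?|//]; exfalso; lia.
Qed.

Lemma one2E : one2 R = mono 0 0. Proof. by []. Qed.

Lemma series_linear_comp (f g : S -> S) : series_linear f -> series_linear g -> series_linear (f \o g).
Proof. by move=> lf lg c x y; rewrite /comp lg lf. Qed.

Let contrl b n a : ord n a -> ord n (mul2 a b).
Proof. by move=> a0; rewrite -[n]addn0; apply: ord_mul2. Qed.
Let contrr a n b : ord n b -> ord n (mul2 a b).
Proof. by move=> b0; rewrite -[n]add0n; apply: ord_mul2. Qed.

(** Both sides are linear in each argument and respect [ord], so [lin_ext] reduces the identity to
    monomials, one argument at a time. The same scheme gives associativity and the laws of
    substitution. *)
Lemma mul2C : commutative (@mul2 R).
Proof.
move=> a b; move: a.
apply: (lin_ext (mul2_linl b) (mul2_linr b)) => [||p q]; try by auto.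
move: b; apply: (lin_ext (mul2_linr _) (mul2_linl _)) => [||r s]; try by auto.
by rewrite !mul2_mono2 addnC [X in mono _ X]addnC.
Qed.

Lemma mul2A : associative (@mul2 R).
Proof.
move=> a b c; move: a.
apply: (lin_ext (mul2_linl _)
  (series_linear_comp (mul2_linl c) (mul2_linl b))) => [||p q] /=; try by auto.
move: b.
apply: (lin_ext (series_linear_comp (mul2_linr _) (mul2_linl c))
  (series_linear_comp (mul2_linl c) (mul2_linr _))) => [||r s] /=; try by auto.
move: c.
apply: (lin_ext (series_linear_comp (mul2_linr _) (mul2_linr _))
   (mul2_linr _)) => [||r' s'] /=; try by auto.
by rewrite !mul2_mono2 !addnA.
Qed.

Lemma mul1_2 : left_id (one2 R) (@mul2 R).
Proof.
by move=> a; apply: seriesP => j k; rewrite one2E mul2_mono /= !subn0.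
Qed.

Lemma mul2Dl : left_distributive (@mul2 R) +%R.
Proof. by move=> a b c; have := mul2_linl c 1 a b; rewrite !scale1r. Qed.

Lemma one2_neq0 : one2 R != 0.
Proof.
apply/eqP => /(congr1 (fun a : S => a 0%N 0%N)).
by rewrite /one2 coef0 /= => /eqP; rewrite oner_eq0.
Qed.

HB.instance Definition _ := GRing.Zmodule_isComNzRing.Build S
  mul2A mul2C mul1_2 mul2Dl one2_neq0.

Lemma series_scalerAl (c : C) (a b : S) : c *: (a * b) = c *: a * b.
Proof.
apply: seriesP => j k; rewrite coefZ [LHS]mulr_sumr; apply: eq_bigr => p _.
by rewrite mulr_sumr; apply: eq_bigr => q _; rewrite coefZ mulrA.
Qed.
HB.instance Definition _ := GRing.Lmodule_isLalgebra.Build C S series_scalerAl.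
Lemma series_scalerAr (c : C) (a b : S) : c *: (a * b) = a * (c *: b).
Proof. by rewrite mulrC series_scalerAl mulrC. Qed.
HB.instance Definition _ := GRing.Lalgebra_isAlgebra.Build C S series_scalerAr.

End SeriesRing.

(** * Substitution and the exponential *)

Section Substitution.
Variable R : realType.
Local Notation C := R[i].
Local Notation S := (series2 R).
Implicit Types a b c d e : S.

Lemma mul2E a b : mul2 a b = a * b. Proof. by []. Qed.
Lemma coefM a b j k : (a * b) j k =
  \sum_(p < j.+1) \sum_(q < k.+1) a p q * b (j - p)%N (k - q)%N.
Proof. by []. Qed.

Lemma pow2E a n : pow2 a n = a ^+ n.
Proof. by elim: n => // n IH; rewrite exprS -IH. Qed.

Lemma coef1 j k : (1 : S) j k = ((j == 0%N) && (k == 0%N))%:R.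
Proof. by []. Qed.

Lemma mono0 : mono R 0 0 = 1. Proof. by []. Qed.

Lemma monoM p q r s : mono R p q * mono R r s = mono R (p + r) (q + s).
Proof. exact: mul2_mono2. Qed.

Lemma coef_monoM p q a j k : (mono R p q * a) j k =
  if (p <= j)%N && (q <= k)%N then a (j - p)%N (k - q)%N else 0.
Proof. exact: mul2_mono. Qed.

Lemma monoX p q n : mono R p q ^+ n = mono R (n * p) (n * q).
Proof. by elim: n => // n IH; rewrite exprS IH monoM !mulSn. Qed.

Lemma monoE p q : mono R p q = mono R 1 0 ^+ p * mono R 0 1 ^+ q.
Proof. by rewrite !monoX monoM !muln0 !muln1 addn0. Qed.

Lemma ordM m n a b : ord m a -> ord n b -> ord (m + n) (a * b).
Proof. exact: ord_mul2. Qed.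

Lemma ordMr n a b : ord n a -> ord n (a * b).
Proof. by move=> a0; rewrite -[n]addn0; apply: ordM. Qed.

Lemma ordMl n a b : ord n b -> ord n (a * b).
Proof. by move=> b0; rewrite -[n]add0n; apply: ordM. Qed.

Lemma ordX b n : ord 1 b -> ord n (b ^+ n).
Proof.
by move=> b1; elim: n => // n IH; rewrite exprS -add1n; apply: ordM.
Qed.

Arguments ordX {b} n b1 j k _.

Lemma ord_X : ord 1 (mono R 1 0).
Proof. by case=> [|j] [|k]. Qed.

Lemma ord_Y : ord 1 (mono R 0 1).
Proof. by case=> [|j] [|k]. Qed.

Lemma ord1P a : a 0%N 0%N = 0 -> ord 1 a.
Proof. by move=> a0 [|j] [|k]. Qed.

Lemma ord1_coef a : ord 1 a -> a 0%N 0%N = 0.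
Proof. by apply. Qed.

(** Here z and zbar are independent variables, replaced by [b] and [c]. This covers both composition
    ([c] the conjugate of [b]) and the exponential, so that their laws need only one proof. When [b]
    and [c] have order 1 the truncation at j + k loses nothing. *)
Definition subst a b c : S := fun j k =>
  \sum_(p < (j + k).+1) \sum_(q < (j + k).+1) a p q * (b ^+ p * c ^+ q) j k.

Lemma subst_linear b c : series_linear (fun a => subst a b c).
Proof.
move=> x a a'; apply: seriesP => j k; rewrite coefD coefZ /subst.
rewrite mulr_sumr -big_split /=; apply: eq_bigr => p _.
rewrite mulr_sumr -big_split /=; apply: eq_bigr => q _.
by rewrite coefD coefZ mulrDl mulrA.
Qed.

Lemma substD a a' b c : subst (a + a') b c = subst a b c + subst a' b c.
Proof. by have := subst_linear b c 1 a a'; rewrite !scale1r. Qed.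

Lemma subst0 b c : subst 0 b c = 0.
Proof.
have := subst_linear b c (-1) 0 0.
by rewrite scaler0 addr0 scaleN1r addNr.
Qed.

Lemma substZ x a b c : subst (x *: a) b c = x *: subst a b c.
Proof. by have := subst_linear b c x a 0; rewrite subst0 !addr0. Qed.

Lemma subst_ord a b c n : ord 1 b -> ord 1 c -> ord n a -> ord n (subst a b c).
Proof.
move=> b1 c1 an j k jk; rewrite /subst big1 // => p _; rewrite big1 // => q _.
have [pq|pq] := ltnP (p + q) n; first by rewrite an // mul0r.
rewrite (ordM (ordX p b1) (ordX q c1)) ?mulr0 //; lia.
Qed.

Lemma subst_mono p q b c : ord 1 b -> ord 1 c ->
  subst (mono R p q) b c = b ^+ p * c ^+ q.
Proof.
move=> b1 c1; apply: seriesP => j k; rewrite /subst.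
(* For p + q > j + k the monomial may lie outside the truncated range, but then both sides vanish
   for reasons of order. *)
have [pq|pq] := leqP (p + q) (j + k); last first.
  rewrite (ordM (ordX p b1) (ordX q c1)) // big1 // => p' _.
  rewrite big1 // => q' _; rewrite /mono; case: eqP => [pE|]; last by rewrite mul0r.
  case: eqP => [qE|]; last by rewrite mul0r.
  by rewrite pE qE (ordM (ordX p b1) (ordX q c1)) ?mulr0.
have pj : (p < (j + k).+1)%N by lia.
have qk : (q < (j + k).+1)%N by lia.
rewrite (bigD1 (Ordinal pj)) //= (bigD1 (Ordinal qk)) //=.
rewrite /mono !eqxx /= mul1r !big1 ?addr0 // => i ne.
- rewrite big1 // => i' _; case: eqP => [ip|_]; last by rewrite mul0r.
  by move: ne; rewrite -val_eqE /= ip eqxx.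
- case: (_ =P q) => [iq|_]; last by rewrite mul0r.
  by move: ne; rewrite -val_eqE /= iq eqxx.
Qed.

Lemma mul_linear_l b : series_linear (fun a => a * b).
Proof. exact: mul2_linl. Qed.
Lemma mul_linear_r b : series_linear (fun a => b * a).
Proof. exact: mul2_linr. Qed.

Lemma substM a a' b c : ord 1 b -> ord 1 c ->
  subst (a * a') b c = subst a b c * subst a' b c.
Proof.
move=> b1 c1; move: a.
apply: (lin_ext (series_linear_comp (subst_linear b c) (mul_linear_l a'))
  (series_linear_comp (mul_linear_l _) (subst_linear b c))).
- by move=> n a an; apply/subst_ord/ordMr.
- by move=> n a an; apply/ordMr/subst_ord.
move=> p q /=; move: a'.
apply: (lin_ext (series_linear_comp (subst_linear b c) (mul_linear_r _))
  (series_linear_comp (mul_linear_r _) (subst_linear b c))).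
- by move=> n a an; apply/subst_ord/ordMl.
- by move=> n a an; apply/ordMl/subst_ord.
move=> r s; rewrite /= monoM !subst_mono // !exprD.
by rewrite mulrACA.
Qed.

Lemma subst1 b c : ord 1 b -> ord 1 c -> subst 1 b c = 1.
Proof. by move=> b1 c1; rewrite -mono0 subst_mono // !expr0 mulr1. Qed.

Lemma substX a b c n : ord 1 b -> ord 1 c ->
  subst (a ^+ n) b c = subst a b c ^+ n.
Proof.
move=> b1 c1; elim: n => [|n IH]; first by rewrite !expr0 subst1.
by rewrite !exprS substM // IH.
Qed.

Lemma subst_subst a b c d e : ord 1 b -> ord 1 c -> ord 1 d -> ord 1 e ->
  subst (subst a b c) d e = subst a (subst b d e) (subst c d e).
Proof.
move=> b1 c1 d1 e1; have bd := subst_ord d1 e1 b1; have cd := subst_ord d1 e1 c1.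
move: a; apply: (lin_ext (series_linear_comp (subst_linear d e) (subst_linear b c))
  (subst_linear _ _)).
- by move=> n a an; apply: subst_ord => //; apply: subst_ord.
- by move=> n a an; apply: subst_ord.
by move=> p q /=; rewrite !subst_mono // substM // !substX.
Qed.

Lemma subst_id a : subst a (mono R 1 0) (mono R 0 1) = a.
Proof.
have o1 := ord_X; have o2 := ord_Y.
move: a; apply: (lin_ext (subst_linear _ _) (L2 := id)) => // [n a|p q].
  exact: subst_ord.
by rewrite subst_mono // [RHS]monoE.
Qed.

(** * Conjugation and composition *)

Lemma conj2E a j k : conj2 a j k = (a k j)^*. Proof. by []. Qed.

Lemma conj2D a b : conj2 (a + b) = conj2 a + conj2 b.
Proof. by apply: seriesP => j k; rewrite conj2E coefD rmorphD. Qed.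

Lemma conj2N a : conj2 (- a) = - conj2 a.
Proof. by apply: seriesP => j k; rewrite conj2E coefN rmorphN. Qed.

Lemma conj2Z x a : conj2 (x *: a) = x^* *: conj2 a.
Proof. by apply: seriesP => j k; rewrite conj2E coefZ rmorphM. Qed.

Lemma conj2K : involutive (@conj2 R).
Proof. by move=> a; apply: seriesP => j k; rewrite !conj2E conjcK. Qed.

Lemma conj2M a b : conj2 (a * b) = conj2 a * conj2 b.
Proof.
apply: seriesP => j k; rewrite conj2E !coefM rmorph_sum exchange_big /=.
apply: eq_bigr => p _.
rewrite rmorph_sum; apply: eq_bigr => q _.
by rewrite rmorphM.
Qed.

Lemma conj2_mono p q : conj2 (mono R p q) = mono R q p.
Proof. by apply: seriesP => j k; rewrite conj2E /mono conjc_nat andbC. Qed.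

Lemma conj2_1 : conj2 1 = 1 :> S.
Proof. exact: conj2_mono. Qed.

Lemma conj2X a n : conj2 (a ^+ n) = conj2 a ^+ n.
Proof.
elim: n => [|n IH]; first by rewrite !expr0 conj2_1.
by rewrite !exprS conj2M IH.
Qed.

Lemma ord_conj2 n a : ord n a -> ord n (conj2 a).
Proof. by move=> an j k jk; rewrite conj2E an ?conjc0 // addnC. Qed.

Lemma conj2_subst a b c : conj2 (subst a b c) = subst (conj2 a) (conj2 c) (conj2 b).
Proof.
apply: seriesP => j k; rewrite conj2E /subst rmorph_sum [RHS]exchange_big addnC.
apply: eq_bigr => p _; rewrite rmorph_sum; apply: eq_bigr => q _.
rewrite rmorphM; congr (_ * _).
by rewrite [in RHS]mulrC -!conj2X -conj2M.
Qed.

Lemma comp2E a b : comp2 a b = subst a b (conj2 b).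
Proof.
apply: seriesP => j k; rewrite /comp2; apply: eq_bigr => p _.
by apply: eq_bigr => q _; rewrite !pow2E.
Qed.

Lemma comp2D a a' b : comp2 (a + a') b = comp2 a b + comp2 a' b.
Proof. by rewrite !comp2E substD. Qed.

Lemma comp2Z x a b : comp2 (x *: a) b = x *: comp2 a b.
Proof. by rewrite !comp2E substZ. Qed.

Lemma comp2B a a' b : comp2 (a - a') b = comp2 a b - comp2 a' b.
Proof. by rewrite comp2D -scaleN1r comp2Z scaleN1r. Qed.

Lemma comp2M a a' b : ord 1 b -> comp2 (a * a') b = comp2 a b * comp2 a' b.
Proof. by move=> b1; rewrite !comp2E substM //; apply: ord_conj2. Qed.

Lemma comp2_ord n a b : ord 1 b -> ord n a -> ord n (comp2 a b).
Proof. by move=> b1 an; rewrite comp2E; apply: subst_ord => //; apply: ord_conj2. Qed.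

Lemma conj2_comp a b : conj2 (comp2 a b) = comp2 (conj2 a) b.
Proof. by rewrite !comp2E conj2_subst conj2K. Qed.

Lemma comp2A a b c : ord 1 b -> ord 1 c ->
  comp2 (comp2 a b) c = comp2 a (comp2 b c).
Proof.
move=> b1 c1; rewrite [comp2 a b]comp2E comp2E subst_subst ?comp2E //;
  try exact: ord_conj2.
by rewrite conj2_subst conj2K.
Qed.

Lemma comp2_mono p q b : ord 1 b ->
  comp2 (mono R p q) b = b ^+ p * conj2 b ^+ q.
Proof. by move=> b1; rewrite comp2E subst_mono //; apply: ord_conj2. Qed.

Lemma comp2_z2l b : ord 1 b -> comp2 (z2 R) b = b.
Proof. by move=> b1; rewrite comp2_mono // expr0 expr1 mulr1. Qed.

Lemma comp2_z2r a : comp2 a (z2 R) = a.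
Proof. by rewrite comp2E conj2_mono subst_id. Qed.

Lemma ord_z2 : ord 1 (z2 R). Proof. exact: ord_X. Qed.

(** The one-variable exponential series in z, seen in two variables. Since zbar is absent, the value
    substituted for it in [exp2E] is arbitrary. *)
Definition exps : S := fun p q => if q == 0%N then (p`!%:R)^-1 else 0.

Lemma exp2E a c : exp2 a = subst exps a c.
Proof.
apply: seriesP => j k; rewrite /exp2 /subst; apply: eq_bigr => n _.
rewrite big_ord_recl /= big1 => [|i _]; last by rewrite mul0r.
by rewrite expr0 mulr1 addr0 pow2E.
Qed.

Lemma exp2_subst a b c : ord 1 a -> ord 1 b -> ord 1 c ->
  subst (exp2 a) b c = exp2 (subst a b c).
Proof.
by move=> a1 b1 c1; rewrite (exp2E a a) subst_subst // -exp2E.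
Qed.

Lemma comp2_exp2 a b : ord 1 a -> ord 1 b ->
  comp2 (exp2 a) b = exp2 (comp2 a b).
Proof. by move=> a1 b1; rewrite !comp2E exp2_subst //; apply: ord_conj2. Qed.

Lemma conj2_exp2 a : conj2 (exp2 a) = exp2 (conj2 a).
Proof.
apply: seriesP => j k; rewrite conj2E /exp2 rmorph_sum addnC.
apply: eq_bigr => n _.
by rewrite rmorphM fmorphV rmorph_nat !pow2E -conj2X.
Qed.

Lemma exp2_coef0 a : exp2 a 0%N 0%N = 1.
Proof. by rewrite /exp2 big_ord1 /= invr1 mul1r. Qed.

(** Only the power of exponent j + k contributes, with a binomial coefficient that turns 1/(j+k)!
    into 1/(j! k!). This is the universal case of [exp2D]. *)
Lemma exp2_XY j k :
  exp2 (mono R 1 0 + mono R 0 1) j k = (j`!%:R)^-1 * (k`!%:R)^-1.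
Proof.
have cXY n : ((mono R 1 0 + mono R 0 1) ^+ n) j k =
    if n == (j + k)%N then 'C(n, k)%:R else 0.
  rewrite exprDn coef_sum.
  under eq_bigr => i _ do rewrite -monoE.
  case: eqP => [->|ne].
    have kk : (k < (j + k).+1)%N by lia.
    rewrite (bigD1 (Ordinal kk)) //= big1 => [|i ni].
      rewrite addr0 addnK -scaler_nat coefZ /mono !eqxx mulr1 //.
    rewrite -scaler_nat coefZ /mono (_ : (k == i) = false) ?andbF ?mulr0 //.
    by apply/eqP => ki; case/eqP: ni; apply: val_inj.
  rewrite big1 // => i _; rewrite -scaler_nat coefZ /mono.
  have := ltn_ord i => ?.
  case: eqP => [?|_]; last by rewrite mulr0.
  case: eqP => [?|_]; last by rewrite mulr0.
  by exfalso; lia.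
rewrite /exp2 big_ord_recr /= big1 => [|n _].
  rewrite add0r pow2E cXY eqxx.
  have fj m : (m`!%:R : C) != 0 by rewrite pnatr_eq0 -lt0n fact_gt0.
  rewrite -invfM -natrM.
  have <- := @bin_fact (j + k) k (leq_addl _ _).
  rewrite addnK natrM invfM mulrAC mulVf ?mul1r //.
    by rewrite mulnC.
  by rewrite pnatr_eq0 -lt0n bin_gt0 leq_addl.
rewrite pow2E cXY; have := ltn_ord n; case: eqP => [|_]; last by rewrite mulr0.
lia.
Qed.

(** The identity is first compared coefficientwise for the two coordinates z and zbar; substituting
    [a] and [b] for them gives the general case. *)
Lemma exp2D a b : ord 1 a -> ord 1 b -> exp2 (a + b) = exp2 a * exp2 b.
Proof.
move=> a1 b1.
have o1 := ord_X; have o2 := ord_Y.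
have XY : exp2 (mono R 1 0 + mono R 0 1) = exp2 (mono R 1 0) * exp2 (mono R 0 1).
  apply: seriesP => j k; rewrite exp2_XY coefM.
  have ex p q : exp2 (mono R 1 0) p q = if q == 0%N then (p`!%:R)^-1 else 0.
    by rewrite (exp2E _ (mono R 0 1)) subst_id.
  have ey p q : exp2 (mono R 0 1) p q = if p == 0%N then (q`!%:R)^-1 else 0.
    rewrite -[mono R 0 1]conj2_mono -conj2_exp2 conj2E ex.
    by case: eqP; rewrite ?conjc0 // conjc_inv conjc_nat.
  rewrite big_ord_recr /= big1 => [|i _].
    rewrite add0r big_ord_recl /= big1 => [|i _].
      by rewrite ex ey subnn subn0 addr0 eqxx.
    by rewrite ex /= mul0r.
  rewrite big1 // => q _; rewrite ey subn_eq0 leqNgt ltn_ord.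
  by rewrite mulr0.
have := congr1 (fun x => subst x a b) XY.
rewrite substM // !exp2_subst //; last exact: ordD.
by rewrite substD !subst_mono // !expr0 !expr1 mulr1 mul1r.
Qed.

Lemma exp2_0 : exp2 0 = 1 :> S.
Proof.
apply: seriesP => j k; rewrite /exp2 big_ord_recl big1 => [|n _].
  by rewrite addr0 pow2E expr0 fact0 invr1 mul1r.
by rewrite pow2E lift0 exprS mul0r coef0 mulr0.
Qed.

End Substitution.

(** * Triangular linear systems and formal inverses *)

Section Triangular.
Variable R : realType.
Local Notation C := R[i].
Local Notation S := (series2 R).
Implicit Types a b c d x w : S.

Lemma coefM00 a b : (a * b) 0%N 0%N = a 0%N 0%N * b 0%N 0%N.
Proof. by rewrite coefM !big_ord1. Qed.

Lemma sum_delta (j k n m : nat) (c : C) : (j < n)%N -> (k < m)%N ->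
  \sum_(p < n) \sum_(q < m) (if (p == j :> nat) && (q == k :> nat) then c else 0)
  = c.
Proof.
move=> jn km; rewrite (bigD1 (Ordinal jn)) //= (bigD1 (Ordinal km)) //=.
rewrite !eqxx /= !big1 ?addr0 // => i ne.
- rewrite big1 // => i' _; case: eqP => [ip|//].
  by case/eqP: ne; apply: val_inj.
- case: (_ =P k) => [iq|//].
  by case/eqP: ne; apply: val_inj.
Qed.

(** The linear operator that sends z^p zbar^q to [M p q]. Composition operators and the operator of
    the conjugacy equation both have this form, triangular with respect to the total degree. *)
Definition linmap (M : nat -> nat -> S) x : S := fun j k =>
  \sum_(p < (j + k).+1) \sum_(q < (j + k).+1) x p q * M p q j k.

Definition lower (M : nat -> nat -> S) x j k : C :=
  \sum_(p < (j + k).+1) \sum_(q < (j + k).+1)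
    if (p + q < j + k)%N then x p q * M p q j k else 0.

(* Where the diagonal entry vanishes, 0^-1 = 0 makes the solution vanish. *)
Definition tri_step M w x : S := fun j k =>
  (M j k j k)^-1 * (w j k - lower M x j k).

(** Each iteration of [tri_step] settles one more total degree, so j + k + 1 iterations are enough
    for the coefficient at (j, k), whatever the starting series. *)
Definition tri_solve M w : S := fun j k => iter (j + k).+1 (tri_step M w) 0 j k.

Lemma lower_ext M x y j k : (forall p q, (p + q < j + k)%N -> x p q = y p q) ->
  lower M x j k = lower M y j k.
Proof.
move=> xy; apply: eq_bigr => p _; apply: eq_bigr => q _.
by case: ifP => // pq; rewrite xy.
Qed.

Lemma tri_solveE M w j k : tri_solve M w j k =
  (M j k j k)^-1 * (w j k - lower M (tri_solve M w) j k).
Proof.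
have st m : forall n j k, (j + k < m)%N -> (j + k < n)%N ->
    iter m (tri_step M w) 0 j k = iter n (tri_step M w) 0 j k.
  elim: m => // m IH [|n] // {}j {}k jm jn; rewrite !iterS /tri_step.
  by congr (_ * (_ - _)); apply: lower_ext => p q pq; apply: IH; lia.
rewrite /tri_solve iterS {1}/tri_step; congr (_ * (_ - _)).
by apply: lower_ext => p q pq; apply: st.
Qed.

Definition triangular (M : nat -> nat -> S) := forall p q j k,
  (j + k <= p + q)%N -> (j, k) <> (p, q) -> M p q j k = 0.

Lemma linmap_lower M x j k : triangular M ->
  linmap M x j k = lower M x j k + x j k * M j k j k.
Proof.
move=> tM.
rewrite -(@sum_delta j k (j + k).+1 (j + k).+1 (x j k * M j k j k)); try lia.
rewrite -big_split; apply: eq_bigr => p _.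
rewrite -big_split; apply: eq_bigr => q _ /=.
case: ifPn => [pq|]; first by case: ifPn; rewrite ?addr0 // => /andP[/eqP ? /eqP ?]; lia.
rewrite -leqNgt add0r => jk; case: ifPn => [/andP[/eqP-> /eqP->] //|npq].
rewrite tM ?mulr0 // => -[ej ek]; move: npq.
by rewrite -ej -ek !eqxx.
Qed.

Lemma tri_solveP M w j k : triangular M -> M j k j k != 0 ->
  linmap M (tri_solve M w) j k = w j k.
Proof.
move=> tM nz; rewrite linmap_lower // tri_solveE mulrC mulrA mulfV // mul1r.
by rewrite addrC subrK.
Qed.

(** By induction on the degree, each coefficient is forced either by its equation or, where the
    diagonal entry vanishes, by the explicit condition on [x]. This is what yields the hermitian
    symmetry of [basic_phi]. *)
Lemma tri_unique M x : triangular M ->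
  (forall j k, M j k j k != 0 -> linmap M x j k = 0) ->
  (forall j k, M j k j k = 0 -> x j k = 0) -> x = 0.
Proof.
move=> tM h1 h2; suff H n : ord n x.
  by apply: seriesP => j k; apply: (H (j + k).+1).
elim: n => // n IH j k; rewrite ltnS => jk.
have [/h2//|nz] := eqVneq (M j k j k) 0.
have := h1 _ _ nz; rewrite linmap_lower // /lower big1 => [|p _].
  by rewrite add0r => /eqP; rewrite mulf_eq0 (negPf nz) orbF => /eqP.
rewrite big1 // => q _; case: ifP => // pq; rewrite IH ?mul0r //; lia.
Qed.

Lemma linmap_comp b x : linmap (fun p q => b ^+ p * conj2 b ^+ q) x = comp2 x b.
Proof. by rewrite comp2E. Qed.

Lemma linmapB M M' x :
  linmap (fun p q => M p q - M' p q) x = linmap M x - linmap M' x.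
Proof.
apply: seriesP => j k; rewrite coefB /linmap -sumrB; apply: eq_bigr => p _.
by rewrite -sumrB; apply: eq_bigr => q _; rewrite coefB mulrBr.
Qed.

Lemma linmap_mono x : linmap (mono R) x = x.
Proof.
rewrite -[RHS]subst_id; apply: seriesP => j k; apply: eq_bigr => p _.
by apply: eq_bigr => q _; rewrite -monoE.
Qed.

Lemma congM m n a a' b b' : ord m a' -> ord n b ->
  ord m.+1 (a - a') -> ord n.+1 (b - b') -> ord (m + n).+1 (a * b - a' * b').
Proof.
move=> am bn aa bb.
have -> : a * b - a' * b' = (a - a') * b + a' * (b - b').
  by rewrite mulrBl mulrBr addrA subrK.
by apply: ordD; [rewrite -addSn|rewrite -addnS]; apply: ordM.
Qed.

(** Leading terms multiply. Consequently composition with [b] is triangular, with diagonal entry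
    la^p conj(la)^q at z^p zbar^q. *)
Lemma monomial_lead (la : C) b p q : ord 2 (b - la *: z2 R) ->
  ord (p + q).+1 (b ^+ p * conj2 b ^+ q - (la ^+ p * la^* ^+ q) *: mono R p q).
Proof.
have X1 r (l : C) c e : ord 1 e -> ord 2 (c - l *: e) ->
    ord r.+1 (c ^+ r - l ^+ r *: e ^+ r).
  move=> e1 ce; elim: r => [|r IH].
    by rewrite !expr0 scale1r subrr.
  have c1 : ord 1 c.
    by rewrite -(subrK (l *: e) c); apply: ordD; [exact: ord_le ce|exact: ordZ].
  rewrite !exprS -scalerA scalerAr scalerAl -[r.+1]add1n; apply: congM => //.
  - exact: ordZ.
  - exact: ordX.
move=> bl.
have cl : ord 2 (conj2 b - la^* *: mono R 0 1).
  have := ord_conj2 bl; rewrite conj2D conj2N conj2Z conj2_mono //.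
have c1 : ord 1 (conj2 b).
  rewrite -(subrK (la^* *: mono R 0 1) (conj2 b)); apply: ordD.
    exact: ord_le cl.
  exact/ordZ/ord_Y.
rewrite monoE -scalerA scalerAr scalerAl; apply: congM.
- exact/ordZ/ordX/ord_X.
- exact: ordX.
- by apply: X1; first exact: ord_X.
- by apply: X1; first exact: ord_Y.
Qed.

Lemma monomial_diag (la : C) b p q j k : ord 2 (b - la *: z2 R) ->
  (j + k <= p + q)%N ->
  (b ^+ p * conj2 b ^+ q) j k = la ^+ p * la^* ^+ q * mono R p q j k.
Proof.
move=> bl jk; have := @monomial_lead la b p q bl j k jk.
by rewrite coefB coefZ => /eqP; rewrite subr_eq0 => /eqP.
Qed.

Lemma mono_neq p q j k : (j, k) <> (p, q) -> mono R p q j k = 0.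
Proof.
move=> ne; rewrite /mono; case: eqP => [ej|//]; case: eqP => [ek|//].
by case: ne; rewrite ej ek.
Qed.

Lemma mono_diag p q : mono R p q p q = 1.
Proof. by rewrite /mono !eqxx. Qed.

Lemma triangular_comp (la : C) b : ord 2 (b - la *: z2 R) ->
  triangular (fun p q => b ^+ p * conj2 b ^+ q).
Proof.
by move=> bl p q j k jk ne; rewrite (monomial_diag bl jk) mono_neq ?mulr0.
Qed.

Lemma tangent_ord b : ord 2 (b - 1 *: z2 R) -> ord 1 b.
Proof.
rewrite scale1r => b2; rewrite -(subrK (z2 R) b).
by apply: ordD; [exact: ord_le b2|exact: ord_z2].
Qed.

(** The equation b' o b = z is a triangular system for b' whose diagonal entries are all 1. *)
Lemma left_inverse b : ord 2 (b - 1 *: z2 R) ->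
  exists2 b', ord 2 (b' - 1 *: z2 R) & comp2 b' b = z2 R.
Proof.
move=> b2; have tM := triangular_comp b2.
pose M p q := b ^+ p * conj2 b ^+ q.
have M1 j k : M j k j k = 1.
  by rewrite /M (monomial_diag b2 (leqnn _)) mono_diag rmorph1 !expr1n !mulr1.
pose b' := tri_solve M (z2 R).
have e : comp2 b' b = z2 R.
  rewrite -linmap_comp; apply: seriesP => j k.
  by apply: tri_solveP => //; rewrite -[X in X != 0]/(M j k j k) M1 oner_eq0.
(* In degree at most 1 the only lower coefficient is b'(0), which is zero, so b' and b' o b agree
   there. *)
exists b' => //; rewrite scale1r => j k jk; rewrite coefB -e -linmap_comp.
rewrite (linmap_lower _ _ _ tM) -[X in _ * X]/(M j k j k) M1 mulr1 /lower big1 ?add0r ?subrr // => p _.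
rewrite big1 // => q _; case: ifP => // pq.
have -> : p = 0%N :> nat by lia.
have -> : q = 0%N :> nat by lia.
by rewrite {1}/b' tri_solveE /lower !big_ord1 /= subr0 mulr0 mul0r.
Qed.

(** The left inverse b' is again tangent to the identity, hence has a left inverse c of its own, and
    c = c o (b' o b) = b makes b' two-sided. *)
Lemma has_inverse2 b : ord 2 (b - 1 *: z2 R) -> exists2 b', ord 1 b' & inverse2 b b'.
Proof.
move=> b2; have [b' b'2 b'b] := left_inverse b2.
have [c c2 cb'] := left_inverse b'2.
have o1 := tangent_ord b2; have o2 := tangent_ord b'2; have o3 := tangent_ord c2.
have cE : c = b by rewrite -(comp2_z2r c) -b'b -comp2A // cb' comp2_z2l.
exists b' => //; split=> //; first exact: ord1_coef.
by rewrite -{1}cE.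
Qed.

End Triangular.

(** * Basic normalization *)

Section Charge.
Variable R : realType.
Local Notation C := R[i].
Local Notation S := (series2 R).
Implicit Types (a b x : S) (c d : int).

(* Up to degree [m], [a] is multiplied by [mu ^+ c] under a rotation
   [z -> mu z]. *)
Definition charge (c : int) (m : nat) a := forall p q,
  (p + q < m)%N -> p%:Z - q%:Z != c -> a p q = 0.

Definition is_radial a := forall m, charge 0 m a.

Lemma chargeD c m a b : charge c m a -> charge c m b -> charge c m (a + b).
Proof. by move=> ha hb p q pq ne; rewrite coefD ha // hb // addr0. Qed.

Lemma chargeZ c m l a : charge c m a -> charge c m (l *: a).
Proof. by move=> ha p q pq ne; rewrite coefZ ha // mulr0. Qed.

Lemma chargeM c d m a b : charge c m a -> charge d m b -> charge (c + d) m (a * b).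
Proof.
move=> ha hb p q pq ne; rewrite coefM big1 // => i _; rewrite big1 // => j _.
have ip := ltn_ord i; have jq := ltn_ord j.
have [ec|nc] := eqVneq (i%:Z - j%:Z) c; last by rewrite ha ?mul0r //; lia.
rewrite hb ?mulr0 //; first lia.
by apply: contra ne => /eqP <-; rewrite -ec; lia.
Qed.

Lemma charge1 m : charge 0 m (1 : S).
Proof.
move=> p q _ ne; rewrite coef1; case: eqP => [pE|//]; case: eqP => [qE|//].
by move: ne; rewrite pE qE.
Qed.

Lemma chargeX m a n : charge 0 m a -> charge 0 m (a ^+ n).
Proof.
move=> ha; elim: n => [|n IH]; first by rewrite expr0; apply: charge1.
by rewrite exprS -[0]addr0; apply: chargeM.
Qed.

Lemma charge_conj2 c m a : charge c m a -> charge (- c) m (conj2 a).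
Proof.
move=> ha p q pq ne; rewrite conj2E ha ?conjc0 //; first lia.
by apply: contra ne => /eqP <-; lia.
Qed.

Lemma charge_exp2 m a : charge 0 m a -> charge 0 m (exp2 a).
Proof.
move=> ha p q pq ne; rewrite /exp2 big1 // => n _.
by rewrite pow2E (chargeX _ ha) ?mulr0.
Qed.

Lemma radial0 a j k : is_radial a -> j != k -> a j k = 0.
Proof. by move=> ra jk; apply: (ra (j + k).+1) => //; lia. Qed.

Lemma radialP a : (forall j k, j != k -> a j k = 0) -> is_radial a.
Proof. by move=> h m p q _ ne; apply: h; lia. Qed.

Lemma radialE a : is_radial a -> a = radial (fun j => a j j).
Proof.
move=> ra; apply: seriesP => j k; rewrite /radial.
by case: eqVneq => [->//|ne]; rewrite radial0.
Qed.

Lemma radial_is_radial (al : nat -> C) : is_radial (radial al).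
Proof. by apply: radialP => j k; rewrite /radial => /negPf ->. Qed.

(** Only the terms with p = q survive, and they involve [b] and [c] through (b c)^p alone. *)
Lemma subst_radial a b (c : S) b' (c' : S) : is_radial a -> b * c = b' * c' ->
  subst a b c = subst a b' c'.
Proof.
move=> ra bc; apply: seriesP => j k; apply: eq_bigr => p _; apply: eq_bigr => q _.
have [->|ne] := eqVneq (p : nat) q; first by rewrite -!exprMn bc.
by rewrite (radial0 ra ne) !mul0r.
Qed.

Lemma charge_comp m a b : is_radial a -> charge 0 m (b * conj2 b) ->
  charge 0 m (comp2 a b).
Proof.
move=> ra hb j k jk ne; rewrite comp2E /subst big1 // => p _.
rewrite big1 // => q _; have [->|pq] := eqVneq (p : nat) q.
  by rewrite -exprMn (chargeX _ hb) ?mulr0.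
by rewrite (radial0 ra pq) mul0r.
Qed.

(** The hypothesis says that |b(z)| = |z|, and a radial series sees nothing but |z|. *)
Lemma comp_radial a b : is_radial a -> b * conj2 b = mono R 1 1 ->
  comp2 a b = a.
Proof.
move=> ra hb; rewrite -[RHS]subst_id comp2E; apply: subst_radial => //.
by rewrite hb monoM.
Qed.

Lemma powers_split (la : C) u p q :
  (la *: (z2 R * u)) ^+ p * conj2 (la *: (z2 R * u)) ^+ q =
  (la ^+ p * la^* ^+ q) *: (mono R p q * (u ^+ p * conj2 u ^+ q)).
Proof.
rewrite conj2Z conj2M conj2_mono !exprZn !exprMn.
rewrite -scalerAl -scalerAr scalerA; congr (_ *: _).
by rewrite mulrACA -monoE.
Qed.

Lemma lead_ord (la : C) u : u 0%N 0%N = 1 -> ord 2 (la *: (z2 R * u) - la *: z2 R).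
Proof.
move=> u0; rewrite -scalerBr; apply: ordZ; rewrite -[X in _ - X]mulr1 -mulrBr.
apply: (@ordM R 1 1); first exact: ord_z2.
by apply: ord1P; rewrite coefB u0 coef1 subrr.
Qed.

Variable la : C.
Hypothesis la1 : la * la^* = 1.
Hypothesis nonres : forall p q, p != q -> la ^+ p * la^* ^+ q != 1.

(** An equality would give la^p conj(la)^(q+1) = 1 after multiplication by conj(la), which
    nonresonance forbids unless p = q + 1. *)
Lemma nonres1 p q : p%:Z - q%:Z != 1 -> la ^+ p * la^* ^+ q != la.
Proof.
move=> pq; apply: contraNneq (@nonres p q.+1 _) => [e|]; last by lia.
by rewrite exprSr mulrA e la1.
Qed.

(** A map conjugating two normal forms commutes with rotations. If [H] does so below degree p + q,
    the lower terms create only charge 1 in both composites; for p - q different from 1 the equation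
    reduces to la^p conj(la)^q H_pq = la H_pq, whence H_pq = 0. *)
Lemma equivariant H u v : ord 2 (H - 1 *: z2 R) ->
  is_radial u -> u 0%N 0%N = 1 -> is_radial v -> v 0%N 0%N = 1 ->
  comp2 H (la *: (z2 R * u)) = comp2 (la *: (z2 R * v)) H ->
  forall m, charge 1 m H.
Proof.
move=> H2 ru u0 rv v0 e; have H1 := tangent_ord H2.
elim=> // m IH p q; rewrite ltnS => pq ne.
have [pq0|pq0] := posnP (p + q).
  have -> : p = 0%N by lia.
  have -> : q = 0%N by lia.
  exact: ord1_coef.
(* A lower monomial of charge 1 composed with the normal form keeps charge 1, because [u] is radial;
   it cannot reach (p, q). *)
have lhs : comp2 H (la *: (z2 R * u)) p q = H p q * (la ^+ p * la^* ^+ q).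
  have lu := lead_ord la u0.
  rewrite -linmap_comp (linmap_lower _ _ _ (triangular_comp lu)).
  rewrite (monomial_diag lu (leqnn _)) mono_diag mulr1 /lower big1 ?add0r // => i _.
  rewrite big1 // => j _; case: ifP => // ij.
  have [ec|nc] := eqVneq (i%:Z - j%:Z) 1; last by rewrite IH ?mul0r //; lia.
  rewrite powers_split coefZ coef_monoM; case: ifP; rewrite ?mulr0 // => le.
  have ruv : is_radial (u ^+ i * conj2 u ^+ j).
    move=> n; rewrite -[0]addr0; apply: chargeM; apply: chargeX => //.
    by rewrite -[0]oppr0; apply: charge_conj2.
  by rewrite (radial0 ruv) ?mulr0 //; lia.
(* In the product of [H] with v o H, a proper lower term of [H] has charge 1, hence positive degree;
   its cofactor then has degree below [m], where v o H is known to have charge 0. *)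
have rhs : comp2 (la *: (z2 R * v)) H p q = la * H p q.
  rewrite comp2Z comp2M // comp2_z2l // coefZ; congr (_ * _).
  have A0 : comp2 v H 0%N 0%N = 1.
    by rewrite comp2E /subst !big_ord1 /= !expr0 v0 mul1r mulr1.
  have cA : charge 0 m (comp2 v H).
    by apply: charge_comp => //; rewrite -(subrr 1); apply/chargeM/charge_conj2.
  rewrite coefM -[RHS](@sum_delta _ p q p.+1 q.+1) //.
  apply: eq_bigr => i _; apply: eq_bigr => j _.
  have ip := ltn_ord i; have jq := ltn_ord j.
  case: ifPn => [/andP[/eqP-> /eqP->]|nij]; first by rewrite !subnn A0 mulr1.
  have [ec|nc] := eqVneq (i%:Z - j%:Z) 1; last by rewrite IH ?mul0r //; lia.
  by rewrite cA ?mulr0 //; lia.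
have := congr1 (fun x : S => x p q) e; rewrite /= lhs rhs mulrC => /eqP.
rewrite -subr_eq0 -mulrBl mulf_eq0 subr_eq0 (negPf (nonres1 ne)) /=.
by move/eqP.
Qed.

(** * Solving the conjugacy equation *)

Section Basic.
Variables (r g : S).
Hypothesis r_radial : is_radial r.
Hypothesis r0 : r 0%N 0%N = 1.
Hypothesis g0 : g 0%N 0%N = 0.
Hypothesis g_herm : conj2 g = g.

Let kappa : C := 0 +i* (2 * pi).
Definition germ : S := la *: (z2 R * (r * expi2 g)).
(** The matrix of the cohomological operator x |-> x o F - x, whose diagonal entries la^p conj(la)^q
    - 1 vanish exactly for p = q. *)
Definition basic_matrix p q : S := germ ^+ p * conj2 germ ^+ q - mono R p q.
(** The equation is solved off the diagonal; on the diagonal the convention 0^-1 = 0 selects the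
    solution without terms p = q. *)
Definition basic_phi : S := tri_solve basic_matrix (- g).
Definition basic_Phi : S := z2 R * expi2 basic_phi.
Definition basic_n : S := comp2 basic_phi germ - basic_phi + g.
Definition basic_N : S := la *: (z2 R * (r * expi2 basic_n)).

Lemma expi2E a : expi2 a = exp2 (kappa *: a). Proof. by []. Qed.

Lemma unit_coef0 a : (r * expi2 a) 0%N 0%N = 1.
Proof. by rewrite coefM00 r0 expi2E exp2_coef0 mul1r. Qed.

Lemma germ_ord2 : ord 2 (germ - la *: z2 R).
Proof. exact/lead_ord/unit_coef0. Qed.

Lemma germ_ord : ord 1 germ.
Proof. exact/ordZ/ordMr/ord_z2. Qed.

Lemma basic_matrix_tri : triangular basic_matrix.
Proof.
move=> p q j k jk ne; rewrite /basic_matrix coefB (triangular_comp germ_ord2) // mono_neq //.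
by rewrite subr0.
Qed.

Lemma basic_matrix_diag p q : basic_matrix p q p q = la ^+ p * la^* ^+ q - 1.
Proof. by rewrite /basic_matrix coefB (monomial_diag germ_ord2) // mono_diag mulr1. Qed.

Lemma la_diag p : la ^+ p * la^* ^+ p = 1.
Proof. by rewrite -exprMn la1 expr1n. Qed.

Lemma basic_phi_diag p : basic_phi p p = 0.
Proof.
by rewrite /basic_phi tri_solveE basic_matrix_diag la_diag subrr invr0 mul0r.
Qed.

Lemma linmap_basic x : linmap basic_matrix x = comp2 x germ - x.
Proof. by rewrite linmapB linmap_comp linmap_mono. Qed.

Lemma basic_matrix_neq0 p q : p != q -> basic_matrix p q p q != 0.
Proof. by move=> pq; rewrite basic_matrix_diag subr_eq0 nonres. Qed.

(** Off the diagonal the triangular system is solved exactly and cancels [g]; only resonant terms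
    are left in [basic_n]. *)
Lemma basic_n_radial : is_radial basic_n.
Proof.
apply: radialP => j k jk; rewrite /basic_n coefD -linmap_basic tri_solveP ?addNr //.
  exact: basic_matrix_tri.
exact: basic_matrix_neq0.
Qed.

(** The operator commutes with conjugation and [g] is hermitian, so conj(phi) - phi is mapped to
    conj(n) - n, which has no off-diagonal terms. Its diagonal vanishes as well, and [tri_unique]
    applies. *)
Lemma basic_phi_herm : conj2 basic_phi = basic_phi.
Proof.
apply/eqP; rewrite -subr_eq0; apply/eqP; apply: (tri_unique basic_matrix_tri).
  move=> j k nz; have jk : j != k.
    by apply: contraNneq nz => ->; rewrite basic_matrix_diag la_diag subrr.
  have -> : linmap basic_matrix (conj2 basic_phi - basic_phi) =
      conj2 basic_n - basic_n.
    rewrite linmap_basic /basic_n !(conj2D, conj2N) conj2_comp comp2B g_herm.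
    ring.
  by rewrite coefB conj2E !(radial0 basic_n_radial) ?conjc0 ?subrr // eq_sym.
move=> j k; have [->|/basic_matrix_neq0/eqP//] := eqVneq j k.
by rewrite coefB conj2E basic_phi_diag conjc0 subrr.
Qed.

Lemma ord_phi : ord 1 basic_phi.
Proof. exact/ord1P/basic_phi_diag. Qed.

Lemma basic_n0 : basic_n 0%N 0%N = 0.
Proof.
rewrite /basic_n coefD coefB basic_phi_diag g0.
by rewrite (ord1_coef (comp2_ord germ_ord ord_phi)) subr0 addr0.
Qed.

Lemma ord_n : ord 1 basic_n. Proof. exact/ord1P/basic_n0. Qed.

Lemma ord_g : ord 1 g. Proof. exact: ord1P. Qed.

Lemma basic_Phi_ord2 : ord 2 (basic_Phi - 1 *: z2 R).
Proof.
rewrite -[basic_Phi]scale1r; apply: lead_ord; exact: exp2_coef0.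
Qed.

Lemma ord_Phi : ord 1 basic_Phi.
Proof. exact/ordMr/ord_z2. Qed.

(** For hermitian phi the exponent 2 pi i phi is purely imaginary, so it cancels against its
    conjugate. *)
Lemma basic_Phi_norm : basic_Phi * conj2 basic_Phi = mono R 1 1.
Proof.
rewrite conj2M conj2_mono conj2_exp2 mulrACA monoM -exp2D; last first.
- exact/ord_conj2/ordZ/ord_phi.
- exact/ordZ/ord_phi.
rewrite !scale2E conj2Z basic_phi_herm -scalerDl.
have -> : 0 +i* (2 * pi) + (0 +i* (2 * pi))^* = 0 :> C.
  by apply/eqP; rewrite eq_complex /= addr0 subrr !eqxx.
by rewrite scale0r exp2_0 mulr1.
Qed.

Lemma comp2_expi2 a b : ord 1 a -> ord 1 b ->
  comp2 (expi2 a) b = expi2 (comp2 a b).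
Proof.
by move=> a1 b1; rewrite !expi2E comp2_exp2 ?comp2Z //; apply: ordZ.
Qed.

Lemma expi2D a b : ord 1 a -> ord 1 b -> expi2 (a + b) = expi2 a * expi2 b.
Proof.
by move=> a1 b1; rewrite !expi2E scalerDr exp2D //; apply: ordZ.
Qed.

(** As Phi preserves |z|, composing with it leaves the radial series [r] and [basic_n] unchanged.
    What remains to compare is the exponents, g + phi o F = phi + n. *)
Lemma basic_conjugacy : comp2 basic_Phi germ = comp2 basic_N basic_Phi.
Proof.
have o1 := germ_ord; have o2 := ord_Phi.
have o3 := comp2_ord o1 ord_phi.
rewrite /basic_N comp2Z !comp2M // !comp2_z2l // !comp2_expi2 //.
- rewrite (comp_radial r_radial basic_Phi_norm).
  rewrite (comp_radial basic_n_radial basic_Phi_norm).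
  rewrite /germ -scalerAl; congr (_ *: _).
  rewrite /basic_Phi -!mulrA; congr (_ * _); rewrite [RHS]mulrCA; congr (_ * _).
  rewrite -(expi2D ord_g o3) -(expi2D ord_phi ord_n).
  congr (expi2 _); rewrite /basic_n; ring.
- exact: ord_n.
- exact: ord_phi.
Qed.

Lemma basic_unit_radial : is_radial (r * expi2 basic_n).
Proof.
move=> m; rewrite -[0]addr0; apply: chargeM => //.
exact/charge_exp2/chargeZ/basic_n_radial.
Qed.

Lemma basic_N_normal : normal_form la basic_N.
Proof.
have ru : is_radial (r * expi2 basic_n - 1).
  move=> m; apply: chargeD; first exact: basic_unit_radial.
  by rewrite -scaleN1r; apply/chargeZ/charge1.
exists (fun j => (r * expi2 basic_n - 1) j j).
  by rewrite coefB unit_coef0 coef1 subrr.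
rewrite -(radialE ru) /basic_N scale2E mul2E add2E; congr (_ *: (_ * _)).
by rewrite -[one2 R]/(1 : S) addrC subrK.
Qed.

Lemma basic_conjugate_by : conjugate_by basic_Phi germ basic_N.
Proof.
have [Phi' o' inv] := has_inverse2 basic_Phi_ord2; exists Phi' => //.
have [_ e1 e2] := inv.
rewrite -comp2A ?germ_ord //.
  by rewrite basic_conjugacy comp2A ?e1 ?comp2_z2r //; apply: ord_Phi.
exact: germ_ord.
Qed.

Lemma tangent_idP Psi : tangent_id Psi <-> ord 2 (Psi - 1 *: z2 R).
Proof.
rewrite scale1r; split => [[h00 h10 h01] [|[|j]] [|[|k]] // _|h].
- by rewrite coefB h00 subrr.
- by rewrite coefB h01 subrr.
- by rewrite coefB h10 subrr.
split; apply/eqP; rewrite -subr_eq0.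
- by have := h 0%N 0%N isT; rewrite coefB /z2 /= !subr0 => ->.
- by have := h 1%N 0%N isT; rewrite coefB /z2 /= => ->.
- by have := h 0%N 1%N isT; rewrite coefB /z2 /= !subr0 => ->.
Qed.

Lemma basic_normalizationP : basic_normalization la germ basic_Phi.
Proof.
split; first split.
- exact/tangent_idP/basic_Phi_ord2.
- exists basic_N; [exact: basic_conjugate_by | exact: basic_N_normal].
exists basic_phi; split => //; first exact: basic_phi_diag.
by move=> j k; rewrite -{1}basic_phi_herm.
Qed.

Lemma basic_normal_formP : basic_normal_form la germ basic_N.
Proof.
by exists basic_Phi; [exact: basic_normalizationP|exact: basic_conjugate_by].
Qed.

(** The map H = Psi o Phi^-1 conjugates the basic normal form to another normal form, so it is
    equivariant and equals z h(|z|^2). Composing back with Phi does not change h. *)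
Lemma normalization_factor Psi : normalization la germ Psi ->
  exists h : S, [/\ is_radial h, h 0%N 0%N = 1 & Psi = basic_Phi * h].
Proof.
move=> [/tangent_idP Psi2 [N [Psi' [Psi'0 _ e2] eN] [al al0 NE]]].
have oF := germ_ord; have oP := ord_Phi; have oPsi := tangent_ord Psi2.
have oPsi' : ord 1 Psi' by exact: ord1P.
pose v := 1 + radial al.
have rv : is_radial v.
  by move=> m; apply: chargeD; [exact: charge1|exact: radial_is_radial].
have v0 : v 0%N 0%N = 1 by rewrite /v coefD coef1 /radial /= al0 addr0.
have {}NE : N = la *: (z2 R * v) by [].
have conjPsi : comp2 Psi germ = comp2 N Psi.
  by rewrite eN !comp2A // ?e2 ?comp2_z2r //; apply: comp2_ord.
have [Phi' o' [_ i1 i2]] := has_inverse2 basic_Phi_ord2.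
have oN : ord 1 basic_N by exact/ordZ/ordMr/ord_z2.
pose H := comp2 Psi Phi'.
have HPhi : comp2 H basic_Phi = Psi by rewrite comp2A // i2 comp2_z2r.
have oH : ord 1 H by exact: comp2_ord.
have H2 : ord 2 (H - 1 *: z2 R).
  have e : H - 1 *: z2 R = comp2 (Psi - 1 *: z2 R) Phi' -
       comp2 (basic_Phi - 1 *: z2 R) Phi'.
    by rewrite !comp2B i1 !scale1r comp2_z2l // opprB addrA subrK.
  by rewrite e; apply: ordB; apply: comp2_ord => //; exact: basic_Phi_ord2.
have HN : comp2 H basic_N = comp2 (la *: (z2 R * v)) H.
  have PN : comp2 Phi' basic_N = comp2 germ Phi'.
    rewrite -[basic_N in LHS]comp2_z2r -i1 -(comp2A basic_N) //.
    rewrite -basic_conjugacy comp2A // -(comp2A Phi') //; last exact: comp2_ord.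
    by rewrite i2 comp2_z2l //; apply: comp2_ord.
  by rewrite -NE /H comp2A // PN -comp2A // conjPsi comp2A.
have cH := equivariant H2 basic_unit_radial (unit_coef0 _) rv v0 HN.
(* The quotient of [H] by z; charge 1 rules out the terms of [H] not divisible by z. *)
pose h : S := fun p q => H p.+1 q.
have zh : H = z2 R * h.
  apply: seriesP => -[|p] q; rewrite coef_monoM /=.
    by apply: (cH q.+1) => //; lia.
  by rewrite /h subn1 subn0.
have rh : is_radial h.
  by apply: radialP => j k jk; apply: (cH (j + k).+2); lia.
exists h; split => //.
  have := H2 1%N 0%N isT; rewrite scale1r coefB /z2 /= => /eqP.
  by rewrite subr_eq0 => /eqP.
rewrite -HPhi zh comp2M // comp2_z2l // (comp_radial rh) //.
exact: basic_Phi_norm.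
Qed.

End Basic.
End Charge.

(** * Geometric growth and convergence *)

Section GeometricBounds.
Variable R : realType.
Local Notation C := R[i].
Local Notation S := (series2 R).
Local Notation normc := (@Normc.normc R).
Implicit Types a b x y K : S.

Lemma normc_ge0 (z : C) : 0 <= normc z.
Proof. by case: z => u v; apply: sqrtr_ge0. Qed.

Lemma normcD (z w : C) : normc (z + w) <= normc z + normc w.
Proof. exact: le_normcD. Qed.

Lemma normc_sum I (r : seq I) P (f : I -> C) :
  normc (\sum_(i <- r | P i) f i) <= \sum_(i <- r | P i) normc (f i).
Proof.
elim/big_rec2: _ => [|i x y _ h]; first by rewrite Normc.normc0.
by apply: le_trans (normcD _ _) _; rewrite lerD2l.
Qed.

Lemma normcX (z : C) n : normc (z ^+ n) = normc z ^+ n.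
Proof.
elim: n => [|n IH]; first by rewrite !expr0 Normc.normc1.
by rewrite !exprS Normc.normcM IH.
Qed.

Lemma normc_conj (z : C) : normc z^* = normc z.
Proof. by case: z => u v /=; rewrite sqrrN. Qed.

Lemma normc_real (u : R) : normc u%:C = `|u|.
Proof. by rewrite /= expr0n addr0 sqrtr_sqr. Qed.

Lemma normc_nat n : normc n%:R = n%:R.
Proof. by rewrite -[n%:R : C](rmorph_nat (real_complex R)) normc_real normr_nat. Qed.

(** A natural base makes the bounded sets a countable family, as genericity requires; the exponent j
    + k + 1 lets the base absorb any constant factor. *)
Definition geom a := exists n : nat,
  forall j k, normc (a j k) <= n%:R ^+ (j + k).+1.

Lemma geomI a (c M : R) :
  (forall j k, normc (a j k) <= c * M ^+ (j + k)) -> 0 <= M -> geom a.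
Proof.
move=> h M0; pose n := (Num.truncn (`|c| + M)).+1.
have nM : `|c| + M <= n%:R by apply/ltW/real_truncnS_gt/num_real.
exists n => j k; apply: le_trans (h j k) _; rewrite exprS.
have c0 := normr_ge0 c; have cc := ler_norm c.
apply: le_trans (_ : `|c| * M ^+ (j + k) <= _).
  by apply: ler_wpM2r => //; apply: exprn_ge0.
apply: ler_pM => //; first exact: exprn_ge0.
  by apply: le_trans nM; rewrite lerDl.
by apply: lerXn2r; rewrite ?nnegrE //; apply: le_trans nM; rewrite lerDr.
Qed.

(** A truncated weighted l1-norm. Geometric growth amounts to a bound uniform in [N] for some
    positive radius ([geom_nrm] and [nrm_geom]). *)
Definition nrm (r : R) N a : R :=
  \sum_(j < N) \sum_(k < N) normc (a j k) * r ^+ (j + k).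

Lemma nrm_ge0 r N a : 0 <= r -> 0 <= nrm r N a.
Proof.
move=> r0; apply: sumr_ge0 => j _; apply: sumr_ge0 => k _.
by rewrite mulr_ge0 ?normc_ge0 ?exprn_ge0.
Qed.

Lemma half_sum N : \sum_(j < N) (2^-1 : R) ^+ j <= 2.
Proof.
have -> : \sum_(j < N) (2^-1 : R) ^+ j = 2 - 2 * 2^-1 ^+ N.
  elim: N => [|N IH]; first by rewrite big_ord0 expr0; lra.
  by rewrite big_ord_recr /= IH exprS; field.
by rewrite gerBl mulr_ge0 // exprn_ge0 // invr_ge0.
Qed.

Lemma sum_half2 (c : R) N (t : nat -> nat -> R) : 0 <= c ->
  (forall j k, t j k <= c * (2^-1 ^+ j * 2^-1 ^+ k)) ->
  \sum_(j < N) \sum_(k < N) t j k <= c * 4.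
Proof.
move=> c0 h; have h0 n : 0 <= (2^-1 : R) ^+ n by rewrite exprn_ge0 // invr_ge0.
apply: le_trans (_ : \sum_(j < N) \sum_(k < N) c * (2^-1 ^+ j * 2^-1 ^+ k) <= _).
  by apply: ler_sum => j _; apply: ler_sum => k _.
under eq_bigr do rewrite -!mulr_sumr.
rewrite -mulr_sumr -mulr_suml; apply: ler_wpM2l => //.
have -> : (4 : R) = 2 * 2 by lra.
by apply: ler_pM; rewrite ?half_sum //; apply: sumr_ge0.
Qed.

Lemma geom_nrm a : geom a -> exists2 r, 0 < r & exists B, forall N, nrm r N a <= B.
Proof.
(* The factor 2 leaves the summable weight 2^-(j+k); using n + 1 keeps the radius positive when n =
   0. *)
move=> [n h]; exists (2 * n.+1%:R)^-1; first by rewrite invr_gt0 mulr_gt0.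
exists (n.+1%:R * 4) => N.
apply: (@sum_half2 _ N (fun j k => normc (a j k) * _ ^+ (j + k))) => // j k.
rewrite /= -exprD invfM exprMn mulrCA [leLHS]mulrC.
apply: ler_wpM2r; first by rewrite exprn_ge0 // invr_ge0.
rewrite exprVn ler_pdivrMr ?exprn_gt0 // -exprS.
apply: le_trans (h _ _) _; apply: lerXn2r; rewrite ?nnegrE //.
by rewrite ler_nat.
Qed.

Lemma nrm_term r N a j k : 0 <= r -> (j < N)%N -> (k < N)%N ->
  normc (a j k) * r ^+ (j + k) <= nrm r N a.
Proof.
move=> r0 jN kN; rewrite /nrm (bigD1 (Ordinal jN)) //= (bigD1 (Ordinal kN)) //=.
rewrite -addrA lerDl; apply: addr_ge0; apply: sumr_ge0 => i _.
  by rewrite mulr_ge0 ?normc_ge0 ?exprn_ge0.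
by apply: sumr_ge0 => i' _; rewrite mulr_ge0 ?normc_ge0 ?exprn_ge0.
Qed.

Lemma nrm_geom r a B : 0 < r -> (forall N, nrm r N a <= B) -> geom a.
Proof.
move=> r0 h; apply: (@geomI _ B r^-1); last by rewrite invr_ge0 ltW.
move=> j k; rewrite exprVn ler_pdivlMr ?exprn_gt0 //.
by apply: le_trans (h (j + k).+1); apply: nrm_term; [exact: ltW|lia|lia].
Qed.

(** Reindexed by p and l = j - p, the left side runs over the triangle p + l < N inside the
    square. *)
Lemma sum_triangle (t : nat -> nat -> R) N : (forall p l, 0 <= t p l) ->
  \sum_(j < N) \sum_(p < j.+1) t p (j - p)%N <= \sum_(p < N) \sum_(l < N) t p l.
Proof.
move=> t0.
have -> : \sum_(j < N) \sum_(p < j.+1) t p (j - p)%N =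
    \sum_(p < N) \sum_(l < N - p) t p l.
  elim: N => [|N IH]; first by rewrite !big_ord0.
  rewrite big_ord_recr IH big_ord_recr [RHS]big_ord_recr /= subnn subSnn.
  rewrite big_ord1 addrA -big_split /=; congr (_ + _).
  by apply: eq_bigr => p _; rewrite subSn ?big_ord_recr // ltnW.
apply: ler_sum => p _.
rewrite (big_ord_widen N (fun l => t p l)) ?leq_subr //.
rewrite [leRHS](bigID (fun l : 'I_N => (l < N - p)%N)) /= lerDl.
exact: sumr_ge0.
Qed.

(** The weights r^(j+k) are multiplicative, so the truncated norm of a convolution is at most the
    product of the truncated norms. *)
Lemma nrm_convolution r N K x y : 0 <= r ->
  (forall j k, normc (x j k) <= normc (y j k) +
     \sum_(p < j.+1) \sum_(q < k.+1) normc (K p q) * normc (x (j - p)%N (k - q)%N)) ->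
  nrm r N x <= nrm r N y + nrm r N K * nrm r N x.
Proof.
move=> r0 h.
pose t p q l m := normc (K p q) * r ^+ (p + q) * (normc (x l m) * r ^+ (l + m)).
have t0 p q l m : 0 <= t p q l m.
  by rewrite /t !mulr_ge0 ?normc_ge0 ?exprn_ge0.
apply: le_trans (_ : \sum_(j < N) \sum_(k < N) (normc (y j k) * r ^+ (j + k) +
    \sum_(p < j.+1) \sum_(q < k.+1) t p q (j - p)%N (k - q)%N) <= _).
  apply: ler_sum => j _; apply: ler_sum => k _.
  apply: le_trans (ler_wpM2r (exprn_ge0 (j + k) r0) (h j k)) _.
  rewrite mulrDl lerD2l mulr_suml; apply: ler_sum => p _.
  rewrite mulr_suml; apply: ler_sum => q _; rewrite /t.
  have -> : (j + k = (p + q) + ((j - p) + (k - q)))%N.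
    by have := ltn_ord p; have := ltn_ord q; lia.
  by rewrite exprD mulrACA.
under eq_bigr do rewrite big_split.
rewrite big_split /= lerD2l.
apply: le_trans (_ : \sum_(p < N) \sum_(l < N) \sum_(q < N) \sum_(m < N) t p q l m <= _).
  apply: le_trans (sum_triangle (t := fun p l =>
    \sum_(q < N) \sum_(m < N) t p q l m) _ _); last first.
    by move=> p l; do 2!apply: sumr_ge0 => ? _.
  apply: ler_sum => j _; rewrite exchange_big; apply: ler_sum => p _.
  by apply: (sum_triangle (t := fun q m => t p q (j - p)%N m)).
rewrite /nrm mulr_suml; apply: ler_sum => p _.
rewrite exchange_big /= mulr_suml; apply: ler_sum => q _.
rewrite mulr_sumr; apply: ler_sum => l _.
by rewrite mulr_sumr.
Qed.

Lemma nrm_shrink r s N a : 0 <= s -> s <= r -> nrm s N a <= nrm r N a.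
Proof.
move=> s0 sr; apply: ler_sum => j _; apply: ler_sum => k _.
apply: ler_wpM2l; first exact: normc_ge0.
by apply: lerXn2r; rewrite ?nnegrE //; apply: le_trans sr.
Qed.

Lemma nrm_small r e N a : 0 <= r -> 0 <= e -> e <= 1 -> a 0%N 0%N = 0 ->
  nrm (e * r) N a <= e * nrm r N a.
Proof.
move=> r0 e0 e1 a0; rewrite /nrm mulr_sumr; apply: ler_sum => j _.
rewrite mulr_sumr; apply: ler_sum => k _.
have [jk0|jk0] := posnP (j + k).
  have -> : j = 0%N :> nat by lia.
  have -> : k = 0%N :> nat by lia.
  by rewrite a0 Normc.normc0 !mul0r mulr0.
rewrite exprMn mulrCA; apply: ler_wpM2r.
  by rewrite mulr_ge0 ?normc_ge0 ?exprn_ge0.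
by rewrite -[leRHS]expr1; apply: ler_wiXn2l.
Qed.

(** A majorant argument: since [K] has no constant term, its norm is at most 1/2 on a small radius,
    and the convolution term is absorbed to give a norm of [x] at most twice that of [y]. *)
Lemma geom_solve K x y : geom y -> geom K -> K 0%N 0%N = 0 ->
  (forall j k, normc (x j k) <= normc (y j k) +
     \sum_(p < j.+1) \sum_(q < k.+1) normc (K p q) * normc (x (j - p)%N (k - q)%N)) ->
  geom x.
Proof.
move=> /geom_nrm[r1 r1p [B1 h1]] /geom_nrm[r2 r2p [B2 h2]] K0 h.
pose r := Num.min r1 r2; have rp : 0 < r by rewrite lt_min r1p r2p.
have B20 : 0 <= B2 by apply: le_trans (h2 0%N); apply/nrm_ge0/ltW.
(* Shrinking the radius by [e] multiplies the norm of [K] by at most [e], and e B2 <= 1/2. *)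
pose e := (2 * (1 + B2))^-1.
have ep : 0 < e by rewrite invr_gt0 mulr_gt0 // ltr_pwDl.
have e1 : e <= 1 by rewrite invf_le1 ?mulr_gt0 ?ltr_pwDl //; lra.
apply: (@nrm_geom (e * r) _ (2 * B1)) => [|N]; first exact: mulr_gt0.
have er0 : 0 <= e * r by rewrite ltW // mulr_gt0.
have err : e * r <= r by rewrite ler_piMl // ltW.
have hx := nrm_convolution N er0 h.
have hy : nrm (e * r) N y <= B1.
  apply: le_trans (h1 N); apply: nrm_shrink => //.
  by apply: le_trans err _; rewrite ge_min lexx.
have hK : nrm (e * r) N K <= 2^-1.
  apply: le_trans (nrm_small N (ltW rp) (ltW ep) e1 K0) _.
  apply: le_trans (_ : e * B2 <= _).
    apply: ler_wpM2l; first exact: ltW.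
    apply: le_trans (h2 N); apply: nrm_shrink; first exact: ltW.
    by rewrite ge_min lexx orbT.
  by rewrite /e mulrC ler_pdivrMr ?mulr_gt0 ?ltr_pwDl //; lra.
have x0 := nrm_ge0 N x er0.
have := ler_wpM2r x0 hK; lra.
Qed.

Lemma geom_convergent2 a : geom a -> convergent2 a.
Proof.
move=> [n h]; exists (2 * n.+1%:R)^-1; first by rewrite invr_gt0 mulr_gt0.
move=> z zr; rewrite /summable.
apply: (@le_lt_trans _ _ (n.+1%:R * 4)%:E); last exact: ltry.
apply: ge_ereal_sup => _ [X [finX _] <-].
(* The infinite sum is a supremum over finite index sets, each contained in a square, where the
   double geometric series bounds it. *)
have [N XN] : exists N, X `<=` `I_N `*` `I_N.
  have [N1 h1] : exists N, forall p, X p -> (p.1 + p.2 < N)%N.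
    have [Y ->] := (finite_seqP X).1 finX.
    exists (\sum_(p <- Y) (p.1 + p.2)).+1 => p pY.
    by rewrite ltnS (big_rem p) //= leq_addr.
  by exists N1 => -[p q] /h1 /= ?; split => /=; lia.
apply: le_trans (lee_fsum_nneg_subset finX (finite_setX (finite_II N) (finite_II N)) _ _) _.
- by move=> p; rewrite !inE => /XN.
- by move=> p _.
rewrite -(pair_fsbig _ (fun p q => `|(normc (a p q * z ^+ p * z^* ^+ q))%:E|%E)) //.
rewrite -fsbig_ord; under eq_bigr do rewrite -fsbig_ord.
under eq_bigr do under eq_bigr do rewrite gee0_abs ?lee_fin ?normc_ge0 //.
under eq_bigr do rewrite sumEFin.
rewrite sumEFin lee_fin.
apply: (@sum_half2 _ N (fun j k => normc (a j k * z ^+ j * z^* ^+ k))) => // j k.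
rewrite !Normc.normcM !normcX normc_conj -mulrA -exprD.
apply: le_trans (_ : n.+1%:R ^+ (j + k).+1 * ((2 * n.+1%:R)^-1) ^+ (j + k) <= _).
  apply: ler_pM; rewrite ?normc_ge0 ?exprn_ge0 ?normc_ge0 //.
    apply: le_trans (h _ _) _; apply: lerXn2r; rewrite ?nnegrE //.
    by rewrite ler_nat.
  by apply: lerXn2r; rewrite ?nnegrE ?normc_ge0 ?invr_ge0 // ltW.
rewrite -exprD invfM exprMn exprS -mulrA ler_wpM2l // mulrCA.
by rewrite -exprMn divff ?expr1n ?mulr1 // pnatr_eq0.
Qed.

(** At the real point r / 2 the family is summable, hence bounded, and its terms have modulus |a_jk|
    (r/2)^(j+k). *)
Lemma convergent2_geom a : convergent2 a -> geom a.
Proof.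
move=> [r r0 h].
have r2 : 0 < r / 2 by rewrite divr_gt0.
have {h} := h (r / 2)%:C; rewrite normc_real gtr0_norm // ltr_pdivrMr // => /(_ _).
rewrite ltr_pMr ?ltr1n // => /(_ isT) sm.
pose t p := (normc (a p.1 p.2 * (r / 2)%:C ^+ p.1 * (r / 2)%:C^* ^+ p.2)).
pose B := fine (\esum_(p in [set: nat * nat]) `|(t p)%:E|)%E.
have hB p : t p <= B.
  rewrite -lee_fin fineK; last by rewrite -summableE.
  apply: esum_ge; exists [set p]; first by split.
  by rewrite fsbig_set1 gee0_abs ?lee_fin ?normc_ge0.
apply: (@geomI _ B (r / 2)^-1); last by rewrite invr_ge0 ltW.
move=> j k; rewrite exprVn ler_pdivlMr ?exprn_gt0 //.
have := hB (j, k); rewrite /t /= !Normc.normcM !normcX normc_conj normc_real.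
by rewrite gtr0_norm // -mulrA -exprD.
Qed.

End GeometricBounds.

(** * Convergent normalizations *)

Section Derivation.
Variable R : realType.
Local Notation C := R[i].
Local Notation S := (series2 R).
Local Notation normc := (@Normc.normc R).
Implicit Types a b x y K h phi : S.

(** The derivation s z d/dz + t zbar d/dzbar: the rotation field for (1, -1), the Euler field for
    (1, 1). *)
Definition deriv (s t : C) a : S := fun j k => (s * j%:R + t * k%:R) * a j k.

Lemma derivE s t a j k : deriv s t a j k = (s * j%:R + t * k%:R) * a j k.
Proof. by []. Qed.

Lemma derivD s t a b : deriv s t (a + b) = deriv s t a + deriv s t b.
Proof. by apply: seriesP => j k; rewrite derivE !coefD mulrDr. Qed.

Lemma derivN s t a : deriv s t (- a) = - deriv s t a.
Proof. by apply: seriesP => j k; rewrite derivE !coefN mulrN. Qed.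

Lemma derivZ s t c a : deriv s t (c *: a) = c *: deriv s t a.
Proof. by apply: seriesP => j k; rewrite derivE !coefZ mulrCA. Qed.

Lemma deriv_sum s t n (f : 'I_n -> S) :
  deriv s t (\sum_i f i) = \sum_i deriv s t (f i).
Proof.
apply: seriesP => j k; rewrite derivE !coef_sum mulr_sumr.
by apply: eq_bigr => i _.
Qed.

Lemma derivM s t a b : deriv s t (a * b) = deriv s t a * b + a * deriv s t b.
Proof.
apply: seriesP => j k; rewrite derivE coefD !coefM mulr_sumr -big_split.
apply: eq_bigr => p _; rewrite mulr_sumr -big_split; apply: eq_bigr => q _ /=.
have pj : (p <= j)%N by rewrite -ltnS.
have qk : (q <= k)%N by rewrite -ltnS.
by rewrite !derivE !natrB //; ring.
Qed.

Lemma deriv1 s t : deriv s t 1 = 0.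
Proof.
apply: seriesP => j k; rewrite derivE coef1.
case: eqP => [->|_]; last by rewrite mulr0.
case: eqP => [->|_]; last by rewrite mulr0.
by rewrite !mulr0 addr0 mul0r.
Qed.

Lemma derivX s t a n : deriv s t (a ^+ n.+1) = n.+1%:R *: (a ^+ n * deriv s t a).
Proof.
elim: n => [|n IH]; first by rewrite expr1 expr0 mul1r scale1r.
rewrite exprS derivM IH -scalerAr mulrA -exprS [deriv s t a * _]mulrC.
by rewrite -[n.+2%:R]natr1 scalerDl scale1r addrC.
Qed.

Lemma ord_deriv s t n a : ord n a -> ord n (deriv s t a).
Proof. by move=> an j k jk; rewrite derivE an ?mulr0. Qed.

Definition exp_trunc n a : S := \sum_(i < n) (i`!%:R)^-1 *: a ^+ i.

Lemma exp_trunc_ord n a : ord 1 a -> ord n (exp2 a - exp_trunc n a).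
Proof.
move=> a1 j k jk; rewrite coefB /exp_trunc coef_sum /exp2.
rewrite [X in _ - X](bigID (fun i : 'I_n => (i < (j + k).+1)%N)) /=.
rewrite [X in _ - (_ + X)]big1 => [|i]; last first.
  by rewrite -leqNgt => ji; rewrite coefZ (ordX (n := i) a1) ?mulr0.
rewrite addr0 (big_ord_widen n (fun i => (i`!%:R)^-1 * pow2 a i j k)) //.
by rewrite -sumrB big1 // => i _; rewrite coefZ pow2E subrr.
Qed.

(** Leibniz sends the truncated exponential of length n + 1 to the derivative of [a] times the one
    of length n. Both truncation errors have order at least n, and n is arbitrary. *)
Lemma deriv_exp2 s t a : ord 1 a -> deriv s t (exp2 a) = deriv s t a * exp2 a.
Proof.
move=> a1; apply/eqP; rewrite -subr_eq0; apply/eqP.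
suff H n : ord n (deriv s t (exp2 a) - deriv s t a * exp2 a).
  by apply: seriesP => j k; apply: (H (j + k).+1).
have e : deriv s t (exp_trunc n.+1 a) = deriv s t a * exp_trunc n a.
  rewrite /exp_trunc big_ord_recl expr0 derivD derivZ deriv1 scaler0 add0r.
  rewrite deriv_sum mulr_sumr; apply: eq_bigr => i _; rewrite lift0 derivZ derivX.
  rewrite scalerA factS natrM invfM mulrAC mulVf ?mul1r ?pnatr_eq0 //.
  by rewrite mulrC -scalerAr.
have -> : deriv s t (exp2 a) - deriv s t a * exp2 a =
    deriv s t (exp2 a - exp_trunc n.+1 a) - deriv s t a * (exp2 a - exp_trunc n a).
  rewrite mulrBr derivD derivN e; ring.
apply: ordB; first exact/ord_deriv/(ord_le (leqnSn n))/exp_trunc_ord.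
exact/ordMl/exp_trunc_ord.
Qed.

Lemma normcM_le a b j k : normc ((a * b) j k) <=
  \sum_(p < j.+1) \sum_(q < k.+1) normc (a p q) * normc (b (j - p)%N (k - q)%N).
Proof.
rewrite coefM; apply: le_trans (normc_sum _ _ _) _; apply: ler_sum => p _.
apply: le_trans (normc_sum _ _ _) _; apply: ler_sum => q _.
by rewrite Normc.normcM.
Qed.

(** The degree factor j + k is below 2^(j+k), so doubling the base absorbs it. *)
Lemma geom_degree a b : geom b ->
  (forall j k, normc (a j k) <= (j + k)%:R * normc (b j k)) -> geom a.
Proof.
move=> [n hn] h; apply: (@geomI _ _ n%:R (2 * n%:R)); last by rewrite mulr_ge0.
move=> j k; apply: le_trans (h j k) _.
rewrite exprMn mulrCA -exprS; apply: ler_pM; rewrite ?ler0n ?normc_ge0 //.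
by rewrite -natrX ler_nat ltnW // ltn_expl.
Qed.

Lemma geom1B a : geom a -> geom (1 - a).
Proof.
move=> [n hn]; apply: (@geomI _ _ (1 + n.+1%:R) n.+1%:R) => // j k.
rewrite coefB; apply: le_trans (normcD _ _) _; rewrite mulrDl mul1r.
rewrite -[- a j k]/(- (a j k : Rcomplex R)) normcN; apply: lerD.
  rewrite coef1; apply: le_trans (_ : 1 <= _).
    by case: (_ && _); rewrite ?Normc.normc0 ?Normc.normc1.
  by apply: exprn_ege1; rewrite ler1n.
rewrite -exprS; apply: le_trans (hn _ _) _; apply: lerXn2r; rewrite ?nnegrE //.
by rewrite ler_nat.
Qed.

(* The rotation derivation j - k kills [h] and is invertible off the diagonal,
   so the logarithmic derivative of [W = exp (kappa phi) * h] recovers [phi];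
   the Euler derivation j + k then bounds the exponential. *)
Lemma geom_exp_factor (c : C) phi h : c != 0 -> ord 1 phi ->
  (forall p, phi p p = 0) -> is_radial h -> h 0%N 0%N = 1 ->
  geom (exp2 (c *: phi) * h) -> geom (exp2 (c *: phi)).
Proof.
move=> c0 phi1 phi_diag rh h0 gW; set W := exp2 _ * h in gW.
have cphi1 : ord 1 (c *: phi) by exact: ordZ.
pose x := deriv 1 (-1) (c *: phi).
have xW : deriv 1 (-1) W = x * W.
  have hd : deriv 1 (-1) h = 0.
    apply: seriesP => j k; rewrite derivE.
    have [->|jk] := eqVneq j k; last by rewrite radial0 // mulr0.
    by rewrite mul1r mulN1r subrr mul0r.
  by rewrite derivM hd mulr0 addr0 deriv_exp2 // mulrA.
have gx : geom x.
  apply: (@geom_solve _ (1 - W) x (deriv 1 (-1) W)).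
  - apply: (geom_degree gW) => j k; rewrite derivE Normc.normcM mul1r mulN1r.
    apply: ler_wpM2r; first exact: normc_ge0.
    apply: le_trans (normcD _ _) _.
    by rewrite -[- _]/(- (k%:R : Rcomplex R)) normcN !normc_nat natrD.
  - exact: geom1B.
  - by rewrite coefB coef1 /W coefM00 exp2_coef0 h0 mul1r subrr.
  (* The logarithmic derivative is recovered without dividing by [W]: the factor 1 - W has no
     constant term, as [geom_solve] demands. *)
  have xE : x = deriv 1 (-1) W + (1 - W) * x by rewrite xW; ring.
  move=> j k; rewrite {1}xE coefD.
  by apply: le_trans (normcD _ _) _; rewrite lerD2l normcM_le.
pose y := deriv 1 1 (c *: phi).
have gy : geom y.
  (* Off the diagonal |j - k| >= 1, so there are no small divisors in passing from j - k to j +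
     k. *)
  apply: (geom_degree gx) => j k; rewrite /x /y !derivE !coefZ.
  have [->|jk] := eqVneq j k.
    by rewrite phi_diag !mulr0 Normc.normc0 mulr0.
  rewrite !mul1r mulN1r -natrD.
  rewrite (Normc.normcM (j + k)%:R) (Normc.normcM (j%:R - k%:R)) normc_nat.
  apply: ler_wpM2l => //; rewrite ler_peMl ?normc_ge0 //.
  have -> : (j%:R - k%:R : C) = (j%:R - k%:R : R)%:C by rewrite rmorphB !rmorph_nat.
  rewrite normc_real; case/orP: (orbN (k <= j)%N) => kj.
    rewrite -natrB // normr_nat ler1n subn_gt0 ltn_neqAle kj andbT.
    by rewrite eq_sym.
  rewrite distrC -natrB ?normr_nat ?ler1n ?subn_gt0; last by lia.
  by rewrite ltnNge.
(* In positive degree, |E_jk| <= (j + k) |E_jk| for the exponential E, and the Euler derivative of E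
   is y E; the series 1 accounts for the constant term. *)
apply: (@geom_solve _ y _ 1) => //.
- by rewrite -[1]subr0; apply: geom1B; exists 0%N => j k; rewrite Normc.normc0 exprS mul0r.
- by rewrite /y derivE coefZ phi_diag !mulr0.
move=> j k; have [jk0|jk0] := posnP (j + k).
  have -> : j = 0%N by lia.
  have -> : k = 0%N by lia.
  rewrite exp2_coef0 coef1 Normc.normc1 lerDl; do 2!apply: sumr_ge0 => ? _.
  by rewrite mulr_ge0 ?normc_ge0.
have jk1 : (1 : R) <= (j + k)%:R by rewrite ler1n.
apply: le_trans (_ : normc (deriv 1 1 (exp2 (c *: phi)) j k) <= _).
  rewrite derivE !mul1r -natrD Normc.normcM normc_nat.
  by rewrite ler_peMl ?normc_ge0.
rewrite deriv_exp2 //; apply: le_trans (normcM_le _ _ _ _) _.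
by rewrite lerDr normc_ge0.
Qed.

Lemma coef_z2M0 a k : (z2 R * a) 0%N k = 0.
Proof. by rewrite coef_monoM. Qed.

Lemma coef_z2MS a j k : (z2 R * a) j.+1 k = a j k.
Proof. by rewrite coef_monoM /= subn1 subn0. Qed.

Lemma geom_shift a : geom a <-> geom (z2 R * a).
Proof.
split=> -[n hn].
  exists n.+1 => -[|j] k.
    by rewrite coef_z2M0 Normc.normc0 exprn_ge0.
  rewrite coef_z2MS; apply: le_trans (hn _ _) _.
  apply: le_trans (_ : n.+1%:R ^+ (j + k).+1 <= _).
    by apply: lerXn2r; rewrite ?nnegrE // ler_nat.
  by rewrite addSn [leRHS]exprS ler_peMl ?exprn_ge0 // ler1n.
apply: (@geomI _ _ (n%:R ^+ 2) n%:R) => // j k.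
have := hn j.+1 k; rewrite coef_z2MS.
by rewrite -exprD addSn.
Qed.

(** After division by z, the factorization of [Psi] reads exp(2 pi i phi) h, from which
    [geom_exp_factor] removes the radial factor. *)
Lemma geom_basic_Phi (la : C) (r g Psi : S) :
  la * la^* = 1 -> (forall p q, p != q -> la ^+ p * la^* ^+ q != 1) ->
  is_radial r -> r 0%N 0%N = 1 ->
  g 0%N 0%N = 0 -> conj2 g = g ->
  normalization la (germ la r g) Psi -> convergent2 Psi ->
  geom (basic_Phi la r g).
Proof.
move=> la1 nres rr r0 g0 gh nPsi /convergent2_geom gPsi.
have [h [rad h0 eP]] := normalization_factor la1 nres rr r0 g0 gh nPsi.
apply/(geom_shift (expi2 _)).1.
have c0 : (0 +i* (2 * pi) : C) != 0.
  by rewrite eq_complex /= eqxx /= mulf_neq0 ?pnatr_eq0 // gt_eqF ?pi_gt0.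
apply: (geom_exp_factor c0 _ _ rad h0).
- exact: ord_phi.
- exact: basic_phi_diag.
by apply/(geom_shift _).2; rewrite mulrA -[X in geom X]eP.
Qed.

End Derivation.

(** * Polynomial dependence on the data *)

Section Extrapolation.
Variable R : realType.
Local Notation C := R[i].
Local Notation normc := (@Normc.normc R).

Definition fdiff (h : C) (p : {poly C}) : {poly C} := p \Po ('X + h%:P) - p.

Lemma fdiff_horner h p x : (fdiff h p).[x] = p.[x + h] - p.[x].
Proof. by rewrite /fdiff hornerD hornerN horner_comp !hornerE. Qed.

Lemma size_fdiff h p : (size (fdiff h p) <= (size p).-1)%N.
Proof.
have H n : forall q : {poly C}, (size q <= n.+1)%N -> (size (fdiff h q) <= n)%N.
  elim: n => [|n IH] q.
    by move/size1_polyC => ->; rewrite /fdiff comp_polyC subrr size_poly0.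
  elim/poly_ind: q => [|q c _].
    by rewrite /fdiff comp_poly0 subrr size_poly0.
  move=> sq; have sq' : (size q <= n.+1)%N.
    have [->|q0] := eqVneq q 0; first by rewrite size_poly0.
    by move: sq; rewrite size_MXaddC (negPf q0).
  (* Discrete product rule; both summands have smaller degree than the polynomial being
     differenced. *)
  have -> : fdiff h (q * 'X + c%:P) = fdiff h q * ('X + h%:P) + h%:P * q.
    by rewrite /fdiff comp_polyD comp_polyM comp_polyX comp_polyC; ring.
  apply: leq_trans (size_polyD _ _) _; rewrite geq_max; apply/andP; split.
    apply: leq_trans (size_polyMleq _ _) _; rewrite size_XaddC addn2 /=.
    exact: IH.
  by rewrite mul_polyC; apply: leq_trans (size_scale_leq _ _) sq'.
case sp: (size p) => [|n]; last by apply: H; rewrite sp.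
move/eqP: sp; rewrite size_poly_eq0 => /eqP ->.
by rewrite /fdiff comp_poly0 subrr size_poly0.
Qed.

Lemma size_iter_fdiff h p k : (size (iter k (fdiff h) p) <= size p - k)%N.
Proof.
elim: k => [|k IH]; first by rewrite subn0.
by rewrite iterS; apply: leq_trans (size_fdiff _ _) _; lia.
Qed.

(* Newton's forward difference formula: the differences of order > d vanish. *)
Lemma extrapolate (p : {poly C}) (h : C) (d y : nat) (B : R) :
  (size p <= d.+1)%N -> 0 <= B ->
  (forall i, (i <= d)%N -> normc p.[i%:R * h] <= B) ->
  normc p.[y%:R * h] <= 3 ^+ y * B.
Proof.
move=> sp B0 hB; pose D k i := (iter k (fdiff h) p).[i%:R * h].
have DS k i : D k.+1 i = D k i.+1 - D k i.
  by rewrite /D iterS fdiff_horner -natr1 mulrDl mul1r.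
(* Only nodes up to [d] are controlled, hence the triangle i + k <= d; each difference doubles the
   bound. *)
have near k : forall i, (i + k <= d)%N -> normc (D k i) <= 2 ^+ k * B.
  elim: k => [|k IH] i ik; first by rewrite expr0 mul1r; apply: hB; lia.
  rewrite DS; apply: le_trans (normcD _ _) _.
  rewrite -[- _]/(- (D k i : Rcomplex R)) normcN.
  have h1 := IH i.+1 _; have h2 := IH i _; rewrite exprS.
  by have {}h1 := h1 ltac:(lia); have {}h2 := h2 ltac:(lia); lra.
have at0 k : normc (D k 0%N) <= 2 ^+ k * B.
  have [kd|kd] := leqP k d; first by apply: near; lia.
  have : size (iter k (fdiff h) p) = 0%N.
    by have := size_iter_fdiff h p k; lia.
  move/eqP; rewrite size_poly_eq0 => /eqP e.
  by rewrite /D e horner0 Normc.normc0 mulr_ge0 // exprn_ge0.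
(* Summing back, D k (i+1) = D k i + D (k+1) i, costs a factor 1 + 2 = 3 per node. *)
have far i : forall k, normc (D k i) <= 3 ^+ i * (2 ^+ k * B).
  elim: i => [|i IH] k; first by rewrite expr0 mul1r.
  have -> : D k i.+1 = D k i + D k.+1 i by rewrite DS addrC subrK.
  apply: le_trans (normcD _ _) _; apply: le_trans (lerD (IH k) (IH k.+1)) _.
  by rewrite !exprS; lra.
by have := far y 0%N; rewrite expr0 mul1r.
Qed.

End Extrapolation.

(** * Coefficients that are continuous and polynomial along lines *)

Section Families.
Variable R : realType.
Variable E : topologicalLmodType R.
Local Notation C := R[i].
Local Notation S := (series2 R).
Local Notation normc := (@Normc.normc R).
Implicit Types (u w : E -> C) (a b : E -> S).

(** Polynomiality is required only along real affine lines of [E], which needs no coordinates on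
    this space and suffices for extrapolation. *)
Definition poly_cts (d : nat) u :=
  [/\ continuous (fun v => complex.Re (u v) : R),
      continuous (fun v => complex.Im (u v) : R) &
      forall v0 v1, exists2 p : {poly C}, (size p <= d.+1)%N &
        forall t : R, u (v0 + t *: (v1 - v0)) = p.[t%:C]].

Lemma poly_cts_le d d' u : (d <= d')%N -> poly_cts d u -> poly_cts d' u.
Proof.
move=> dd [cr ci h]; split => // v0 v1; have [p sp hp] := h v0 v1.
by exists p => //; apply: leq_trans sp _.
Qed.

Lemma eq_poly_cts d u w : u =1 w -> poly_cts d w -> poly_cts d u.
Proof. by move=> /funext ->. Qed.

Lemma poly_cts_const d c : poly_cts d (fun=> c).
Proof.
split=> [||v0 v1]; try by move=> v; apply: cvg_cst.
exists c%:P; first by apply: leq_trans (size_polyC_leq1 _) _.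
by move=> t; rewrite hornerC.
Qed.

Lemma poly_ctsD d u w : poly_cts d u -> poly_cts d w ->
  poly_cts d (fun v => u v + w v).
Proof.
move=> [cr ci h] [cr' ci' h']; split => [v|v|v0 v1].
- under eq_fun do rewrite raddfD.
  exact: (cvgD (cr v) (cr' v)).
- under eq_fun do rewrite raddfD.
  exact: (cvgD (ci v) (ci' v)).
have [p sp hp] := h v0 v1; have [q sq hq] := h' v0 v1.
exists (p + q); first by rewrite (leq_trans (size_polyD _ _)) // geq_max sp sq.
by move=> t; rewrite hp hq hornerD.
Qed.

Lemma poly_ctsM d d' u w : poly_cts d u -> poly_cts d' w ->
  poly_cts (d + d') (fun v => u v * w v).
Proof.
move=> [cr ci h] [cr' ci' h']; split => [v|v|v0 v1].
- have e : (fun v => complex.Re (u v * w v)) =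
      (fun v => complex.Re (u v) * complex.Re (w v)
              - complex.Im (u v) * complex.Im (w v)).
    by apply/funext => x; case: (u x) => ? ?; case: (w x).
  by rewrite e; apply: (cvgB (cvgM (cr v) (cr' v)) (cvgM (ci v) (ci' v))).
- have e : (fun v => complex.Im (u v * w v)) =
      (fun v => complex.Re (u v) * complex.Im (w v)
              + complex.Im (u v) * complex.Re (w v)).
    by apply/funext => x; case: (u x) => ? ?; case: (w x).
  by rewrite e; apply: (cvgD (cvgM (cr v) (ci' v)) (cvgM (ci v) (cr' v))).
have [p sp hp] := h v0 v1; have [q sq hq] := h' v0 v1.
exists (p * q); first by rewrite (leq_trans (size_polyMleq _ _)) //; lia.
by move=> t; rewrite hp hq hornerM.
Qed.

Lemma poly_ctsZ d c u : poly_cts d u -> poly_cts d (fun v => c * u v).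
Proof. by move=> h; rewrite -[d]add0n; apply: poly_ctsM => //; apply: poly_cts_const. Qed.

Lemma poly_ctsN d u : poly_cts d u -> poly_cts d (fun v => - u v).
Proof.
by move=> h; under eq_fun do rewrite -mulN1r; apply: poly_ctsZ.
Qed.

Lemma poly_cts_sum d n (u : 'I_n -> E -> C) : (forall i, poly_cts d (u i)) ->
  poly_cts d (fun v => \sum_i u i v).
Proof.
elim: n u => [|n IH] u h.
  by under eq_fun do rewrite big_ord0; apply: poly_cts_const.
under eq_fun do rewrite big_ord_recl.
apply: poly_ctsD; first exact: h.
by apply: (IH (fun i => u (lift ord0 i))) => i; apply: h.
Qed.

Lemma poly_cts_conj d u : poly_cts d u -> poly_cts d (fun v => (u v)^*).
Proof.
move=> [cr ci h]; split => [v|v|v0 v1].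
- by have -> : (fun v => complex.Re (u v)^*) = (fun v => complex.Re (u v));
    [apply/funext => x; case: (u x)|exact: cr].
- have -> : (fun v => complex.Im (u v)^*) = (fun v => - complex.Im (u v)).
    by apply/funext => x; case: (u x).
  by apply: cvgN; apply: ci.
have [p sp hp] := h v0 v1.
(* The line parameter is real, so conjugating the value conjugates only the coefficients of the
   polynomial. *)
exists (map_poly (@conjc R) p).
  by rewrite size_map_poly.
move=> t; rewrite hp -[t%:C in RHS]conjc_real.
by rewrite (horner_map (@conjc R)).
Qed.

Definition tame a := forall j k, poly_cts (j + k) (fun v => a v j k).

Lemma tame_const (s : S) : tame (fun=> s).
Proof. by move=> j k; apply: poly_cts_const. Qed.

Lemma tameD a b : tame a -> tame b -> tame (fun v => a v + b v).
Proof. by move=> ha hb j k; apply: poly_ctsD; [exact: ha|exact: hb]. Qed.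

Lemma tameN a : tame a -> tame (fun v => - a v).
Proof. by move=> ha j k; apply: poly_ctsN; exact: ha. Qed.

Lemma tameZ c a : tame a -> tame (fun v => c *: a v).
Proof. by move=> ha j k; apply: poly_ctsZ; exact: ha. Qed.

Lemma tameM a b : tame a -> tame b -> tame (fun v => a v * b v).
Proof.
move=> ha hb j k; under eq_fun do rewrite coefM.
apply: (poly_cts_sum (u := fun p v => _)) => p.
apply: (poly_cts_sum (u := fun q v => _)) => q.
apply: poly_cts_le (poly_ctsM (ha p q) (hb (j - p)%N (k - q)%N)).
by have := ltn_ord p; have := ltn_ord q; lia.
Qed.

Lemma tame_conj2 a : tame a -> tame (fun v => conj2 (a v)).
Proof. by move=> ha j k; rewrite addnC; apply: poly_cts_conj; exact: ha. Qed.

Lemma tameX a n : tame a -> tame (fun v => a v ^+ n).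
Proof.
move=> ha; elim: n => [|n IH]; first exact: tame_const.
by under eq_fun do rewrite exprS; apply: tameM.
Qed.

Lemma tame_exp2 a : tame a -> tame (fun v => exp2 (a v)).
Proof.
move=> ha j k; apply: (poly_cts_sum (u := fun n v => _)) => n.
apply: poly_ctsZ; under eq_fun do rewrite pow2E.
exact: tameX.
Qed.

(** The factor z^p zbar^q carries no data, so the degree bound drops by p + q. In a composition this
    offsets exactly the degree p + q of the outer coefficient. *)
Lemma poly_cts_powers la b p q j k : tame b -> (p + q <= j + k)%N ->
  poly_cts (j + k - (p + q)) (fun v =>
    ((la *: (z2 R * b v)) ^+ p * conj2 (la *: (z2 R * b v)) ^+ q) j k).
Proof.
move=> hb pq; apply: eq_poly_cts => [v|].
  by rewrite powers_split coefZ coef_monoM.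
apply: poly_ctsZ; case: (boolP (_ && _)) => [/andP[pj qk]|_]; last exact: poly_cts_const.
have -> : (j + k - (p + q) = (j - p) + (k - q))%N by lia.
have := tameM (tameX p hb) (tameX q (tame_conj2 hb)); exact.
Qed.

Lemma ord_powers la (s : S) p q :
  ord (p + q) ((la *: (z2 R * s)) ^+ p * conj2 (la *: (z2 R * s)) ^+ q).
Proof.
have o : ord 1 (la *: (z2 R * s)) by exact/ordZ/ordMr/ord_z2.
by apply: ordM; apply: ordX => //; apply: ord_conj2.
Qed.

Lemma tame_comp la a b : tame a -> tame b ->
  tame (fun v => comp2 (a v) (la *: (z2 R * b v))).
Proof.
move=> ha hb j k; under eq_fun do rewrite comp2E.
apply: (poly_cts_sum (u := fun p v => _)) => p.
apply: (poly_cts_sum (u := fun q v => _)) => q.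
have [pq|pq] := leqP (p + q) (j + k).
  have := poly_ctsM (ha p q) (poly_cts_powers la hb pq).
  by rewrite subnKC.
apply: (@eq_poly_cts _ _ (fun=> 0)) => [v|]; last exact: poly_cts_const.
by rewrite ord_powers // mulr0.
Qed.

Section BasicTame.
Variables (la : C) (r g : E -> S).
Hypothesis r0 : forall v, r v 0%N 0%N = 1.
Hypothesis r_tame : tame r.
Hypothesis g_tame : tame g.

Let unit_tame : tame (fun v => r v * expi2 (g v)).
Proof. by apply: tameM => //; apply: tame_exp2; apply: tameZ. Qed.

Lemma tame_basic_phi : tame (fun v => basic_phi la (r v) (g v)).
Proof.
suff H n : forall j k, (j + k < n)%N ->
    poly_cts (j + k) (fun v => basic_phi la (r v) (g v) j k).
  by move=> j k; apply: (H (j + k).+1).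
elim: n => // n IH j k; rewrite ltnS => jk.
apply: eq_poly_cts => [v|].
  (* The divisor depends on [la] alone, so the recursion only multiplies and adds coefficients of
     lower degree. *)
  by rewrite /basic_phi tri_solveE basic_matrix_diag.
apply: poly_ctsZ; apply: poly_ctsD; first exact: tameN.
apply: poly_ctsN; apply: (poly_cts_sum (u := fun p v => _)) => p.
apply: (poly_cts_sum (u := fun q v => _)) => q.
case: (boolP (_ < _)%N) => pq; last exact: poly_cts_const.
have pq' := ltnW pq.
apply: (@poly_cts_le ((p + q) + (j + k - (p + q)))); first by rewrite subnKC.
apply: poly_ctsM; first by apply: IH; lia.
rewrite /basic_matrix; under eq_fun do rewrite coefB.
apply: poly_ctsD; last exact: poly_cts_const.
exact: poly_cts_powers.
Qed.

Lemma tame_basic_Phi : tame (fun v => basic_Phi la (r v) (g v)).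
Proof.
apply: tameM; first exact: tame_const.
by apply: tame_exp2; apply: tameZ; apply: tame_basic_phi.
Qed.

Lemma tame_basic_N : tame (fun v => basic_N la (r v) (g v)).
Proof.
apply: tameZ; apply: tameM; first exact: tame_const.
apply: tameM => //; apply: tame_exp2; apply: tameZ.
apply: tameD => //; apply: tameD; last exact/tameN/tame_basic_phi.
by apply: tame_comp => //; apply: tame_basic_phi.
Qed.

End BasicTame.

(** * Dichotomy between universal and generically absent geometric growth *)

Lemma open_normc d u (c : R) : poly_cts d u -> 0 <= c ->
  open [set v | c < normc (u v)].
Proof.
move=> [cr ci _] c0.
have -> : [set v | c < normc (u v)] =
    (fun v => complex.Re (u v) ^+ 2 + complex.Im (u v) ^+ 2 : R) @^-1`
      [set x | c ^+ 2 < x].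
  apply/seteqP; split => v /=; case: (u v) => x y /= h.
    rewrite -(sqr_sqrtr (_ : 0 <= x ^+ 2 + y ^+ 2)); last first.
      by rewrite addr_ge0 ?sqr_ge0.
    by apply: ltrXn2r => //; rewrite nnegrE sqrtr_ge0.
  by rewrite -(ger0_norm c0) -sqrtr_sqr ltr_sqrt // (le_lt_trans _ h) ?sqr_ge0.
apply: open_comp; last exact: open_gt.
move=> v _; apply: cvgD; apply: cvgM; [exact: cr|exact: cr|exact: ci|exact: ci].
Qed.

(** The axioms of a topological vector space make the line through v0 and v1 continuous at parameter
    0, so an initial segment of it stays in [O]. *)
Lemma segment_open (O : set E) v0 v1 : open O -> O v0 ->
  exists m : nat, forall t : R, 0 <= t <= m.+1%:R^-1 -> O (v0 + t *: (v1 - v0)).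
Proof.
move=> oO Ov0.
have cl : (fun t : R^o => v0 + t *: (v1 - v0)) @ (0 : R^o) --> v0.
  have e : v0 = v0 + 0 *: (v1 - v0) by rewrite scale0r addr0.
  rewrite [X in _ --> X]e.
  apply: (@continuous_comp _ _ _ (fun t : R^o => (v0, t *: (v1 - v0)))
    (fun x : E * E => x.1 + x.2)); last exact: add_continuous.
  apply: cvg_pair => /=; first exact: cvg_cst.
  apply: (@continuous_comp _ _ _ (fun t : R^o => (t, v1 - v0))
    (fun x : R^o * E => x.1 *: x.2)); last exact: scale_continuous.
  by apply: (@cvg_pair _ _ _ _ (nbhs (0 : R^o))); [exact: cvg_id|exact: cvg_cst].
have nO : nbhs v0 O by apply: open_nbhs_nbhs; split.
have /nbhs_ballP[e /= e0 he] := cl _ nO.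
exists (Num.truncn e^-1) => t /andP[t0 t1]; apply: he.
rewrite /ball /= sub0r normrN ger0_norm //; apply: le_lt_trans t1 _.
by rewrite invf_plt ?posrE // real_truncnS_gt // num_real.
Qed.

Lemma tame_dichotomy a : tame a ->
  (forall v, geom (a v)) \/ generic [set v | ~ geom (a v)].
Proof.
move=> ha.
pose U n := [set v | exists j k, n%:R ^+ (j + k).+1 < normc (a v j k)].
have oU n : open (U n).
  have -> : U n = \bigcup_j \bigcup_k
      [set v | n%:R ^+ (j + k).+1 < normc (a v j k)].
    apply/seteqP; split => v; first by move=> [j [k h]]; exists j => //; exists k.
    by move=> [j _ [k _ h]]; exists j, k.
  apply: bigcup_open => j _; apply: bigcup_open => k _.
  by apply: open_normc (ha j k) _; rewrite exprn_ge0.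
have [dU|] := pselect (forall n, dense (U n)).
  right; exists U => [n|v hv [n hn]]; first by split.
  have [j [k]] := hv n I; rewrite ltNge => /negP; apply; exact: hn.
(* Failure of density gives a nonempty open [V] disjoint from [U n], on which all the bounds with
   base [n] hold. *)
move=> /existsNP[n /existsNP[V /not_implyP[[v0 Vv0] /not_implyP[oV hV]]]].
left => v; have [m hm] := segment_open v oV Vv0.
(* Extrapolation will give 3^y n^(d+1) with y = (d+1)(m+1), which is the (d+1)-st power of this
   base; the base does not depend on the degree. *)
exists (3 ^ m.+1 * n)%N => j k.
have [_ _ /(_ v0 v)[p sp hp]] := ha j k.
(* With step 1/y the nodes i/y for i <= d lie in [0, 1/(m+1)], where the bound holds, while node
   number y is the parameter 1, that is [v]. *)
set d := (j + k)%N in sp *; pose y := (d.+1 * m.+1)%N.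
have y0 : (y%:R : R) != 0 by rewrite pnatr_eq0 muln_eq0.
have e1 : a v j k = p.[y%:R * (y%:R^-1 : R)%:C].
  rewrite -(rmorph_nat (real_complex R)) -rmorphM mulfV //.
  by rewrite -hp scale1r addrC subrK.
have bd : 3 ^+ y * n%:R ^+ d.+1 = (3 ^ m.+1 * n)%:R ^+ d.+1 :> R.
  by rewrite natrM natrX exprMn -exprM mulnC.
rewrite e1 -bd; apply: (extrapolate _ sp) => [|i id]; first exact: exprn_ge0.
rewrite -(rmorph_nat (real_complex R)) -rmorphM -hp.
rewrite leNgt; apply/negP => h; apply: hV.
exists (v0 + (i%:R / y%:R) *: (v - v0)); split; last by exists j, k.
apply: hm; rewrite divr_ge0 //= ler_pdivrMr; last by rewrite ltr0n muln_gt0.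
by rewrite natrM mulrC mulfK ?pnatr_eq0 // ler_nat; apply: leq_trans id _.
Qed.

End Families.

(** * Irrational rotations and the three families *)

Section Multiplier.
Variables (R : realType) (omega : R).
Local Notation la := (multiplier omega).

Lemma multiplier_norm : la * la^* = 1.
Proof.
rewrite /multiplier; apply/eqP; rewrite eq_complex /=.
by rewrite mulrN opprK -!expr2 cos2Dsin2 eqxx mulrN mulrC addNr eqxx.
Qed.

Lemma multiplierX n :
  la ^+ n = cos (n%:R * (2 * pi * omega)) +i* sin (n%:R * (2 * pi * omega)).
Proof.
rewrite /multiplier; move: (2 * pi * omega) => x.
elim: n => [|n IH]; first by rewrite expr0 mul0r cos0 sin0.
rewrite exprSr IH -[n.+1%:R]natr1 mulrDl mul1r cosD sinD.
by apply/eqP; rewrite eq_complex /= eqxx addrC eqxx.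
Qed.

(** Let y in [0, 1) be the fractional part of |x|. By periodicity cos(2 pi y) = 1, so sin(pi y) = 0,
    which is impossible for 0 < y < 1. *)
Lemma cos_2pi_eq1 (x : R) : cos (2 * pi * x) = 1 ->
  exists m : nat, `|x| = m%:R.
Proof.
move=> c1; have /andP[] := truncn_itv (normr_ge0 x).
move: (Num.truncn _) => m m1 m2; exists m.
pose y := `|x| - m%:R.
have y0 : 0 <= y by rewrite subr_ge0.
have y1 : y < 1 by rewrite ltrBlDl natr1.
have cy : cos (2 * (pi * y)) = 1.
  have cx : cos (2 * pi * `|x|) = 1.
    by case: (ger0P x) => _ //; rewrite mulrN cosN.
  apply: etrans cx; rewrite -(periodicn (@cosD2pi R) m); congr cos.
  by rewrite -mulrnA -[pi *+ _]mulr_natr natrM /y; ring.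
have s0 : sin (pi * y) = 0.
  apply/eqP; rewrite -sqrf_eq0; apply/eqP.
  by move: cy; rewrite mulr_natl cos_mulr2n cos2sin2; lra.
apply/eqP; rewrite -subr_eq0 -/y eq_sym; move: y0; rewrite le_eqVlt.
case/orP => // yp; have h : 0 < pi * y < pi.
  by rewrite mulr_gt0 ?pi_gt0 // gtr_pMr ?pi_gt0.
by have := sin_gt0_pi h; rewrite s0 ltxx.
Qed.

Hypothesis irr : @irrational R omega.

(** An equality would make n omega an integer up to sign, hence omega rational. *)
Lemma multiplierX_neq1 n : (0 < n)%N -> la ^+ n != 1.
Proof.
move=> n0; apply/eqP => e; apply: irr.
have : cos (2 * pi * (n%:R * omega)) = 1.
  have := congr1 (@complex.Re R) e; rewrite multiplierX /= => h.
  by apply: etrans h; congr cos; ring.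
case/cos_2pi_eq1 => m; rewrite normrM normr_nat => em.
have nz : n%:R != 0 :> R by rewrite pnatr_eq0 -lt0n.
have eo : `|omega| = ratr (m%:R / n%:R).
  by rewrite fmorph_div /= !ratr_nat -em mulrAC mulfV // mul1r.
rewrite /rational /=; case: (ger0P omega) eo => _ eo.
  by exists (m%:R / n%:R).
by exists (- (m%:R / n%:R)) => //; rewrite rmorphN /= -eo opprK.
Qed.

(** Since |la| = 1, the common part of the two powers cancels and leaves a positive power of la or
    its conjugate. *)
Lemma multiplier_nonres p q : p != q -> la ^+ p * la^* ^+ q != 1.
Proof.
have gen n m : (la ^+ (m + n) * la^* ^+ n) = la ^+ m.
  by rewrite exprD -mulrA -exprMn multiplier_norm expr1n mulr1.
have genc n m : (la ^+ n * la^* ^+ (m + n)) = (la ^+ m)^*.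
  by rewrite exprD mulrCA -exprMn multiplier_norm expr1n mulr1 -rmorphXn.
move=> pq; have [qp|pq'] := leqP q p.
  rewrite -(subnK qp) gen; apply: multiplierX_neq1; lia.
rewrite -(subnK (ltnW pq')) genc; apply/eqP => /(congr1 (@conjc R)).
rewrite conjcK conjc1; apply/eqP/multiplierX_neq1; lia.
Qed.

End Multiplier.

(** * Common treatment of the three families *)

Section Assembly.
Variables (R : realType) (la : R[i]) (E : topologicalLmodType R).
Local Notation S := (series2 R).

(** Affine rather than linear, so that coordinates of free data and constants from a fixed datum are
    treated alike. *)
Definition affine_cts (u : E -> R) :=
  continuous u /\ forall v0 v1 (t : R), u (v0 + t *: (v1 - v0)) = u v0 + t * (u v1 - u v0).

Lemma affine_poly_cts (u w : E -> R) : affine_cts u -> affine_cts w ->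
  poly_cts 1 (fun v => u v +i* w v).
Proof.
move=> [cu hu] [cw hw]; split => [||v0 v1] //.
exists ((u v0 +i* w v0)%:P + ((u v1 - u v0) +i* (w v1 - w v0)) *: 'X).
  apply: leq_trans (size_polyD _ _) _; rewrite geq_max.
  rewrite (leq_trans (size_polyC_leq1 _)) //=.
  by apply: leq_trans (size_scale_leq _ _) _; rewrite size_polyX.
move=> t; rewrite hu hw !hornerE; apply/eqP; rewrite eq_complex /=.
by rewrite !mulr0 subr0 add0r ![t * _]mulrC !eqxx.
Qed.

Definition rho (f : nat -> R) : S := 1 + radial (fun j => (f j)%:C).

Lemma rho_radial f : is_radial (rho f).
Proof. by move=> m; apply: chargeD; [exact: charge1|exact: radial_is_radial]. Qed.

Lemma rho0 f : f 0%N = 0 -> rho f 0%N 0%N = 1.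
Proof. by move=> f0; rewrite /rho coefD coef1 /radial /= f0 addr0. Qed.

Lemma tame_rho (f : E -> nat -> R) : (forall v, f v 0%N = 0) ->
  (forall j, affine_cts (fun v => f v j)) -> tame (fun v => rho (f v)).
Proof.
move=> f0 af; apply: tameD; first exact: tame_const.
move=> j k; rewrite /radial; have [<-|ne] := eqVneq j k; last exact: poly_cts_const.
(* In degree 0 a [tame] coefficient must be constant, which holds because f_0 = 0; for positive j
   the allowed degree 2j exceeds 1. *)
case: j => [|j].
  by apply: (@eq_poly_cts _ _ _ _ (fun=> 0)) => [v|]; [rewrite f0|exact: poly_cts_const].
apply: (@poly_cts_le _ _ 1); first by lia.
apply: affine_poly_cts; first exact: af.
by split => [v|v0 v1 t]; [exact: cvg_cst|rewrite subrr mulr0 addr0].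
Qed.

Lemma tame_gcoef (g : E -> S) : (forall v, g v 0%N 0%N = 0) ->
  (forall j k, affine_cts (fun v => complex.Re (g v j k)) /\
               affine_cts (fun v => complex.Im (g v j k))) -> tame g.
Proof.
move=> g0 ag j k; have [jk0|jk0] := posnP (j + k).
  apply: (@eq_poly_cts _ _ _ _ (fun=> 0)) => [v|]; last exact: poly_cts_const.
  have -> : j = 0%N by lia.
  by have -> : k = 0%N by lia.
apply: (@poly_cts_le _ _ 1) => //.
apply: (@eq_poly_cts _ _ _ _ (fun v => complex.Re (g v j k) +i* complex.Im (g v j k))).
  by move=> v; case: (g v j k).
by have [] := ag j k; apply: affine_poly_cts.
Qed.

Lemma family_dichotomy (f : E -> nat -> R) (g : E -> S) :
  la * la^* = 1 -> (forall p q, p != q -> la ^+ p * la^* ^+ q != 1) ->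
  (forall v, f v 0%N = 0) -> (forall j, affine_cts (fun v => f v j)) ->
  (forall v, g v 0%N 0%N = 0) -> (forall v, conj2 (g v) = g v) ->
  (forall j k, affine_cts (fun v => complex.Re (g v j k)) /\
               affine_cts (fun v => complex.Im (g v j k))) ->
  let F v := germ la (rho (f v)) (g v) in
  ((forall v : E, exists2 Phi : series2 R,
      basic_normalization la (F v) Phi & convergent2 Phi) \/
   generic [set v : E | forall Psi : series2 R,
      normalization la (F v) Psi -> ~ convergent2 Psi]) /\
  ((forall v : E, exists2 N : series2 R,
      basic_normal_form la (F v) N & convergent2 N) \/
   generic [set v : E | exists2 N : series2 R,
      basic_normal_form la (F v) N & ~ convergent2 N]).
Proof.
move=> la1 nres f0 af g0 gh ag F.
have rt := tame_rho f0 af; have gt := tame_gcoef g0 ag.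
have r0 v := rho0 (f0 v).
have sub (P Q : set E) : P `<=` Q -> generic P -> generic Q.
  by move=> PQ [U hU sU]; exists U => //; apply: subset_trans PQ.
split.
- have [h|h] := tame_dichotomy (tame_basic_Phi la r0 rt gt); [left=> v|right].
    exists (basic_Phi la (rho (f v)) (g v)); last exact: geom_convergent2.
    by apply: basic_normalizationP => //; exact: rho_radial.
  apply: sub h => v ng Psi nPsi cPsi; apply: ng.
  by apply: geom_basic_Phi nPsi cPsi => //; exact: rho_radial.
- have [h|h] := tame_dichotomy (tame_basic_N la r0 rt gt); [left=> v|right].
    exists (basic_N la (rho (f v)) (g v)); last exact: geom_convergent2.
    by apply: basic_normal_formP => //; exact: rho_radial.
  apply: sub h => v ng; exists (basic_N la (rho (f v)) (g v)).
    by apply: basic_normal_formP => //; exact: rho_radial.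
  by move=> /convergent2_geom.
Qed.

Lemma affine_const (c : R) : affine_cts (fun=> c).
Proof. by split => [v|v0 v1 t]; [exact: cvg_cst|rewrite subrr mulr0 addr0]. Qed.

Lemma hermitian2P (g : S) : hermitian2 g -> conj2 g = g.
Proof. by move=> h; apply: seriesP => j k; rewrite [RHS]h. Qed.

End Assembly.

Theorem theorem31 (R : realType) (omega : R) (E : topologicalLmodType R)
    (F : E -> series2 R) (homega : @irrational R omega)
    (hF : diffeo_family (multiplier omega) F) :
  let lambda := multiplier omega in
  ((forall v : E, exists2 Phi : series2 R,
      basic_normalization lambda (F v) Phi & convergent2 Phi) \/
   generic [set v : E | forall Psi : series2 R,
      normalization lambda (F v) Psi -> ~ convergent2 Psi]) /\
  ((forall v : E, exists2 N : series2 R,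
      basic_normal_form lambda (F v) N & convergent2 N) \/
   generic [set v : E | exists2 N : series2 R,
      basic_normal_form lambda (F v) N & ~ convergent2 N]).
Proof.
have la1 := multiplier_norm omega; have nres := multiplier_nonres homega.
pose on_lines (V : lmodType R) (d : E -> V) :=
  forall v0 v1 (t : R), d (v0 + t *: (v1 - v0)) = d v0 + t *: (d v1 - d v0).
have linear_on_lines (V : lmodType R) (d : {linear E -> V}) : on_lines V d.
  by move=> v0 v1 t; rewrite linearD linearZ linearB.
have affine_f (d : E -> fcoef R) : on_lines _ d -> fcoef_continuous d ->
    forall j, affine_cts (fun v => d v j).
  by move=> e cd j; split => [|v0 v1 t]; [exact: cd|rewrite e].
have affine_g (d : E -> gcoef R) : on_lines _ d -> gcoef_continuous d ->
    forall j k, affine_cts (fun v => complex.Re (d v j k)) /\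
                affine_cts (fun v => complex.Im (d v j k)).
  move=> dE cd j k; have [cr ci] := cd j k.
  (* In [Rcomplex R] scaling by a real number acts separately on real and imaginary parts, so both
     are affine along lines. *)
  have e v0 v1 (t : R) : d (v0 + t *: (v1 - v0)) j k =
      (d v0 j k : Rcomplex R) + t *: ((d v1 j k : Rcomplex R) - d v0 j k).
    by rewrite dE.
  by split; split => // v0 v1 t; rewrite e; case: (d v0 j k) (d v1 j k) => ? ? [].
(* In each case [F] is a [germ] by unfolding definitions; a fixed datum enters as a constant
   function on [E]. *)
case: hF => [d [dfun _ _] cf cg|g d [g0 gh _] [dfun _ _] cf|f d [f0 _] [dfun _ _] cg].
- apply: (@family_dichotomy _ _ _ (fun v => (d v).1) (fun v => (d v).2)) => //.
  + by move=> v; have [[]] := dfun v I.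
  + by apply: affine_f cf => v0 v1 t; rewrite linear_on_lines.
  + by move=> v; have [_ []] := dfun v I.
  + by move=> v; have [_ [_ gh _]] := dfun v I; apply: hermitian2P.
  + by apply: affine_g cg => v0 v1 t; rewrite linear_on_lines.
- apply: (@family_dichotomy _ _ _ d (fun=> g)) => //.
  + by move=> v; have [] := dfun v I.
  + exact: affine_f (linear_on_lines _ d) cf.
  + by move=> v; apply: hermitian2P.
  + by move=> j k; split; apply: affine_const.
- apply: (@family_dichotomy _ _ _ (fun=> f) d) => //.
  + by move=> j; apply: affine_const.
  + by move=> v; have [] := dfun v I.
  + by move=> v; have [_ gh _] := dfun v I; apply: hermitian2P.
  + exact: affine_g (linear_on_lines _ d) cg.
Qed.
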